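(* Let $I\subset\mathbb{N}$ be a non-empty proper subset, let $F_I$ be the set of irrationals in $(0,1)$ whose continued fraction entries all lie in $I$, and let $h$ be the quantity associated with $I$ defined in the context. Then: (1) for all $\theta\in[0,1]$, $$\overline{\dim}_{\theta}F_I=\max\{h,\overline{\dim}_{\theta}\{1/b:b\in I\}\},$$ $$\max\{h,\underline{\dim}_{\theta}\{1/b:b\in I\}\}\le\underline{\dim}_{\theta}F_I\le\max\{h,\overline{\dim}_{\theta}\{1/b:b\in I\}\};$$ (2) the maps $\theta\mapsto\overline{\dim}_{\theta}F_I$ and $\theta\mapsto\underline{\dim}_{\theta}F_I$ are continuous at $\theta=0$.
   Context: $\mathbb{N}=\{1,2,3,\ldots\}$ and $|\cdot|$ denotes diameter. $$F_I=\left\{z\in(0,1)\setminus\mathbb{Q}: z=\cfrac{1}{b_1+\cfrac{1}{b_2+\cdots}},\ b_n\in I\text{ for all }n\in\mathbb{N}\right\}.$$ Definition of $h$. Let $X=[0,1]$ and, for $b\in\mathbb{N}$, $S_b(x)=1/(b+x)$. Let $\mathcal{S}$ be the family of maps on $X$ given by $\mathcal{S}=\{S_b:b\in I\}$ if $1\notin I$, and $\mathcal{S}=\{S_b:b\in I,b\ne1\}\cup\{x\mapsto 1/(1+\frac{1}{b+x}):b\in I\}$ if $1\in I$ (this family is a conformal iterated function system with limit set $F_I$). Let $M_n$ be the set of all $n$-fold compositions of maps from $\mathcal{S}$ and, for $\sigma\in M_n$, let $R_\sigma$ be the smallest Lipschitz constant of $\sigma$ on $X$. Put $\phi_n(t)=\sum_{\sigma\in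 M_n}R_\sigma^t\in[0,\infty]$, $\overline{P}(t)=\lim_{n\to\infty}\frac1n\log\phi_n(t)=\inf_n\frac1n\log\phi_n(t)$ for $t>0$ (with $\log\infty=\infty$), and $h=\inf\{t>0:\overline{P}(t)<0\}$. Dimensions. For $\theta\in(0,1]$ and non-empty bounded $E\subset\mathbb{R}^d$: $\overline{\dim}_{\theta}E$ is the infimum of $s\ge0$ such that for all $\epsilon>0$ there is $\delta_0\in(0,1]$ such that for all $\delta\in(0,\delta_0)$ there is a cover $\{U_1,U_2,\ldots\}$ of $E$ with $\delta^{1/\theta}\le|U_i|\le\delta$ for all $i$ and $\sum_i|U_i|^s\le\epsilon$; $\underline{\dim}_{\theta}E$ is the infimum of $s\ge0$ such that for all $\epsilon>0$ and $\delta_0\in(0,1]$ there exist $\delta\in(0,\delta_0)$ and a cover $\{U_1,U_2,\ldots\}$ of $E$ with $\delta^{1/\theta}\le|U_i|\le\delta$ for all $i$ and $\sum_i|U_i|^s\le\epsilon$. Set $\overline{\dim}_0=\underline{\dim}_0=\dim_{\mathrm H}$ (Hausdorff dimension). *)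

(* Defs.v *)
From HB Require Import structures.
From mathcomp Require Import all_boot all_order all_algebra.
From mathcomp Require Import all_classical all_reals all_analysis.

Set Implicit Arguments.
Unset Strict Implicit.
Unset Printing Implicit Defensive.

Import Order.TTheory GRing.Theory Num.Theory.
Import numFieldNormedType.Exports.

Local Open Scope classical_set_scope.
Local Open Scope ring_scope.

(* Natural numbers start at 1 here: digits and the index set I lie in posnat. *)
Definition posnat : set nat := [set n | (0 < n)%N].

Section Dimensions.
Context {R : realType}.
Implicit Types (A E : set R) (D : set nat) (U : nat -> set R).

(* The point 0 is added so that the empty set has diameter 0, not -oo. *)
Definition diam A : \bar R :=
  ereal_sup (0%E |` [set `|x - y|%:E | x in A & y in A]).

(* A cover {U_1, U_2, ...} is a family indexed by an arbitrary D : set nat, so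
   that it may be finite: if all diameters are at least some r > 0, then an
   infinite family has an infinite sum. *)
Definition is_cover E D U := E `<=` \bigcup_(i in D) U i.

Definition cover_sum (s : R) D U : \bar R :=
  \esum_(i in D) (diam (U i) `^ s)%E.

Definition hausdorff_premeasure (s delta : R) E : \bar R :=
  ereal_inf [set v | exists D U,
    [/\ is_cover E D U,
        forall i, D i -> (diam (U i) <= delta%:E)%E
      & v = cover_sum s D U]].

(* The limit as delta tends to 0 is a supremum, by monotonicity. *)
Definition hausdorff_measure (s : R) E : \bar R :=
  ereal_sup [set hausdorff_premeasure s delta E | delta in [set delta | 0 < delta]].

Definition hausdorff_dim E : \bar R :=
  ereal_inf [set s%:E | s in [set s | 0 <= s /\ hausdorff_measure s E = 0%E]].

Definition admissible_cover (theta s eps delta : R) E :=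
  exists D U,
    [/\ is_cover E D U,
        forall i, D i ->
          ((delta `^ theta^-1)%:E <= diam (U i))%E /\ (diam (U i) <= delta%:E)%E
      & (cover_sum s D U <= eps%:E)%E].

(* Meaningful for 0 <= theta <= 1 and E non-empty and bounded. *)
Definition upper_dim (theta : R) E : \bar R :=
  if theta == 0 then hausdorff_dim E else
  ereal_inf [set s%:E | s in [set s | 0 <= s /\
    forall eps, 0 < eps ->
      exists delta0, 0 < delta0 <= 1 /\
        forall delta, 0 < delta < delta0 ->
          admissible_cover theta s eps delta E]].

Definition lower_dim (theta : R) E : \bar R :=
  if theta == 0 then hausdorff_dim E else
  ereal_inf [set s%:E | s in [set s | 0 <= s /\
    forall eps delta0, 0 < eps -> 0 < delta0 <= 1 ->
      exists delta, 0 < delta < delta0 /\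
        admissible_cover theta s eps delta E]].

End Dimensions.

Section ContinuedFractions.
Context {R : realType}.
Implicit Types (I : set nat) (b : nat -> nat).

(* convergent b n = 1 / (b 0 + 1 / (b 1 + ... + 1 / b (n - 1))); the entry
   written b_(n+1) on paper is [b n]. *)
Fixpoint convergent b (n : nat) : R :=
  if n is m.+1 then ((b 0)%:R + convergent (fun k => b k.+1) m)^-1 else 0.

Definition cf_set I : set R :=
  [set z | [/\ 0 < z < 1, irrational z
    & exists b, (forall n, I (b n)) /\ convergent b n @[n --> \oo] --> z]].

Definition reciprocals I : set R := [set b%:R^-1 | b in I].

(* Maps on X = [0, 1] are represented by functions R -> R. *)
Definition cf_map (b : nat) (x : R) : R := (b%:R + x)^-1.

Definition cf_ifs I : set (R -> R) :=
  [set f | (~ I 1%N /\ exists2 b, I b & f = cf_map b) \/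
           (I 1%N /\
             ((exists2 b, I b /\ b <> 1%N & f = cf_map b) \/
              (exists2 b, I b & f = fun x => (1 + (b%:R + x)^-1)^-1)))].

(* The n-fold compositions are collected as functions on R rather than on X.
   For n-fold compositions of maps in [cf_ifs I], with I a set of positive
   integers, this gives the same set: distinct words have distinct restrictions
   to X, by uniqueness of continued fraction expansions. *)
Fixpoint compositions (S : set (R -> R)) (n : nat) : set (R -> R) :=
  if n is m.+1 then [set f \o g | f in S & g in compositions S m]
  else [set idfun].

Definition lipschitz_const (f : R -> R) : \bar R :=
  ereal_inf [set k%:E | k in
    [set k | 0 <= k /\ k.-lipschitz_(`[0, 1]%classic) f]].

Definition phi I (n : nat) (t : R) : \bar R :=
  \esum_(f in compositions (cf_ifs I) n) (lipschitz_const f `^ t)%E.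

(* [lne] is the extended logarithm, with lne +oo = +oo. *)
Definition pressure I (t : R) : \bar R :=
  limn (fun n => (n%:R^-1%:E * lne (phi I n t))%E).

Definition bowen_h I : \bar R :=
  ereal_inf [set t%:E | t in [set t | 0 < t /\ (pressure I t < 0)%E]].

End ContinuedFractions.

Arguments cf_set : clear implicits.
Arguments reciprocals : clear implicits.
Arguments bowen_h : clear implicits.

(* Main.v *)
Require Import Defs.
From mathcomp Require Import all_boot all_order all_algebra.
From mathcomp Require Import all_classical all_reals all_analysis.
From mathcomp Require Import ring lra.

Import Order.TTheory GRing.Theory Num.Theory.
Import numFieldNormedType.Exports.

Set Implicit Arguments.
Unset Strict Implicit.
Unset Printing Implicit Defensive.

Local Open Scope classical_set_scope.
Local Open Scope ring_scope.

(** Write F for the set of continued fractions with digits in I, E for the set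
    of reciprocals of I, and h for the critical exponent of the pressure.

    Everything rests on bounded distortion.  An n-fold composition f of the
    system is a Moebius map (p + p' x) / (q + q' x) of determinant 1 or -1 with
    0 <= q' <= q, so that |f x - f y| lies between R_f |x - y| / 4 and
    R_f |x - y| on [0, 1], where R_f is its Lipschitz constant
    ([compositions_lip]).  Hence R is multiplicative up to the factor 4, and
    Fekete's lemma gives the pressure its meaning: it is negative at t as soon
    as one of the sums phi_n(t), n > 0, is less than 1 ([pressure_lt0]), and
    then the phi_n(s) form a convergent series for every s > t
    ([phi_summable]).

    Upper bound ([cf_set_cover]).  Let s be greater than h and the upper
    dimension of E, and fix a scale delta, with lo = delta^(1/theta).  Follow
    all compositions f as long as R_f > delta.  A child f o g of such an f has
    either lo <= R_(f o g) <= delta, and then its image of F is covered by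
    itself, or R_(f o g) < lo, and then that image is within lo of the point
    f (g 0); these points are the image under f of points that are as close
    to each other as the corresponding points of E, so a cover of E at scale
    delta / R_f serves.  Both kinds cost at most a constant times R^s, and the
    total is at most a constant times the sum of all phi_k(s).  So the cost at
    exponent s is bounded uniformly in delta.

    Lower bounds.  F contains the bilipschitz copy 1/(b + x), b in I, of E
    ([dim_reciprocals_le]).  For the Hausdorff dimension take s < h: then some
    finite set G of n-fold compositions has a sum of (R_f / 4)^s above 1
    ([phi_large]).  If sets of total cost S covered the limit set of G, where S
    is small compared with the gaps between the pieces, then in every piece the
    pigeonhole principle would find a subpiece met by sets of cost at most its
    share of S; in the limit this produces a point of F that can only be
    covered by sets of cost 0 ([no_cheap_cover]).  No measure is constructed.

    Finally the upper dimension of E at theta is at most theta: about 1/delta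
    reciprocals lie above delta and cost delta each, the others lie in
    [0, delta].  Letting theta tend to 0 in
    h <= dim_H F <= upper_dim theta F <= max(h, theta) yields both dim_H F = h
    and the continuity at 0. *)

(** * Powers and unordered sums *)

Section Powers.
Context {R : realType}.
Implicit Types (r x y e : R).

Lemma powR_le r x y : 0 <= r -> 0 <= x -> x <= y -> x `^ r <= y `^ r.
Proof.
by move=> r0 x0 xy; apply: ge0_ler_powR; rewrite ?nnegrE// (le_trans x0).
Qed.

Lemma powR1l r : 1 `^ r = 1 :> R. Proof. by rewrite powR1. Qed.

Lemma expr_small r e : 0 <= r < 1 -> 0 < e -> exists2 n, (0 < n)%N & r ^+ n < e.
Proof.
move=> /andP[r0 r1] e0; have := @cvg_geometric R 1 r.
rewrite ger0_norm// => /(_ r1) /cvgrPdist_lt /(_ e e0) [N _ hN].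
exists N.+1 => //; have := hN N.+1 (leqnSn N).
by rewrite sub0r normrN /= mul1r ger0_norm// exprn_ge0.
Qed.

Lemma geometric_sum_le r n : 0 <= r < 1 -> \sum_(k < n) r ^+ k <= (1 - r)^-1.
Proof.
move=> /andP[r0 r1]; rewrite -[leRHS]mul1r ler_pdivlMr ?subr_gt0//.
suff -> : (\sum_(k < n) r ^+ k) * (1 - r) = 1 - r ^+ n by rewrite gerBl exprn_ge0.
elim: n => [|n IH]; first by rewrite big_ord0 mul0r expr0 subrr.
by rewrite big_ord_recr/= mulrDl IH exprS; ring.
Qed.

Lemma powR_le_exponent (x s t : R) : 0 <= x <= 1 -> 0 <= s < t -> x `^ t <= x `^ s.
Proof.
move=> /andP[x0 x1] /andP[s0 st]; move: x0; rewrite le_eqVlt => /predU1P[<-|x0].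
  by rewrite powR0 ?powR_ge0// gt_eqF// (le_lt_trans s0).
by apply: ger_powR; rewrite ?x0// ltW.
Qed.

End Powers.

Section Esum.
Context {R : realType} {T : choiceType}.
Implicit Types (A B : set T) (w : T -> R) (s : seq T).

Lemma esum_seq A (a : T -> \bar R) s :
    uniq s -> (forall x, x \in s -> A x) ->
  (\sum_(x <- s) a x <= \esum_(x in A) a x)%E.
Proof.
move=> us sA; apply: esum_ge.
have fs : finite_set [set` s] by exact: finite_seq.
exists [set` s]; first by split => // x; exact: sA.
by rewrite (fsbig_seq _ _ us).
Qed.

Lemma esum_le_seq A (a : T -> \bar R) (c : \bar R) :
    (forall s, uniq s -> (forall x, x \in s -> A x) ->
      (\sum_(x <- s) a x <= c)%E) ->
  (\esum_(x in A) a x <= c)%E.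
Proof.
move=> h; apply: ge_ereal_sup => _ [X [fX XA] <-].
rewrite fsbig_finite//=; apply: h => // x.
by rewrite in_fset_set// inE; exact: XA.
Qed.

Lemma sub_esum A B (a : T -> \bar R) : A `<=` B ->
  (\esum_(x in A) a x <= \esum_(x in B) a x)%E.
Proof.
by move=> AB; apply: esum_le_seq => s us sA; apply: esum_seq => // x /sA/AB.
Qed.

Lemma size_le_sum w eta s : (forall x, x \in s -> eta <= w x) ->
  (size s)%:R * eta <= \sum_(x <- s) w x.
Proof.
elim: s => [|x s IH] sw; first by rewrite big_nil mul0r.
rewrite big_cons /= -natr1 mulrDl mul1r addrC lerD//.
  by apply: sw; rewrite mem_head.
by apply: IH => y ys; apply: sw; rewrite inE ys orbT.
Qed.

Lemma esum_finite A w c eta : 0 < eta -> (forall x, A x -> eta <= w x) ->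
  (\esum_(x in A) (w x)%:E <= c%:E)%E -> finite_set A.
Proof.
move=> eta0 Aw sumc; apply: contrapT => /infinite_set_fset infA.
have [B BA sB] := infA (Num.bound (c / eta)).
have Bw x : x \in finmap.enum_fset B -> A x by move=> xB; exact: BA.
have := le_trans (esum_seq _ (finmap.fset_uniq B) Bw) sumc.
rewrite sumEFin lee_fin => sc.
have := le_trans (size_le_sum (fun x xB => Aw _ (Bw x xB))) sc.
rewrite -ler_pdivlMr// leNgt => /negP; apply.
by apply: lt_le_trans (unstable.ltr_bound _) _; rewrite ler_nat.
Qed.

Lemma esum_scale_le (A : set T) (w : T -> R) (c b : R) : 0 <= c ->
  (\esum_(x in A) (w x)%:E <= b%:E)%E -> (\esum_(x in A) (c * w x)%:E <= (c * b)%:E)%E.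
Proof.
move=> c0 Ab; apply: esum_le_seq => s us sA.
rewrite sumEFin -mulr_sumr lee_fin ler_wpM2l// -lee_fin -sumEFin.
exact: le_trans (esum_seq _ us sA) Ab.
Qed.

End Esum.

Section EsumMaps.
Context {R : realType} {T U : choiceType}.

(** The map [h] may identify points, so the left side can be smaller: this is
    what makes it harmless to sum over functions instead of words. *)
Lemma esum_image_le (A : set T) (h : T -> U) (a : U -> \bar R) :
  (\esum_(y in h @` A) a y <= \esum_(x in A) a (h x))%E.
Proof.
case: (pselect (A !=set0)) => [[x0 Ax0]|A0]; last first.
  apply: (@le_trans _ _ 0%E); last first.
    apply: esum_ge; exists set0; last by rewrite fsbig_set0.
    by split=> // x.
  rewrite (_ : h @` A = set0) ?esum_set0// -subset0 => y [x Ax _].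
  by apply: A0; exists x.
have /choice[k kP] : forall y, exists x, (h @` A) y -> A x /\ h x = y.
  move=> y; case: (pselect ((h @` A) y)) => [[x Ax hx]|hy]; last by exists x0.
  by exists x.
apply: esum_le_seq => s us sA.
have sk y : y \in s -> A (k y) /\ h (k y) = y by move=> /sA/kP.
rewrite (_ : \sum_(y <- s) a y = \sum_(x <- map k s) a (h x))%E; last first.
  rewrite big_map big_seq [RHS]big_seq; apply: eq_bigr => y /sk[_ ->] //.
apply: esum_seq.
  by rewrite map_inj_in_uniq// => y z /sk[_ {2}<-] /sk[_ {2}<-] ->.
by move=> _ /mapP[y /sk[Ay _] ->].
Qed.

Lemma esum_disjoint_seq (G : seq U) (A : U -> set T) (B : set T) (a : T -> \bar R) :
    (forall x, (0 <= a x)%E) -> uniq G ->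
    (forall f, f \in G -> A f `<=` B) ->
    (forall f g x, f \in G -> g \in G -> A f x -> A g x -> f = g) ->
  (\sum_(f <- G) \esum_(x in A f) a x <= \esum_(x in B) a x)%E.
Proof.
move=> a0; elim: G B => [|f G IH] B /=.
  by move=> _ _ _; rewrite big_nil; apply: esum_ge0.
move=> /andP[fG uG] AB Adisj; rewrite big_cons (esumID (A f) B); last by [].
apply: leeD.
  by apply: sub_esum => x Ax; split => //; apply: AB Ax; exact: mem_head.
apply: IH => //.
  move=> g gG x Ax; split; first by apply: AB Ax; rewrite inE gG orbT.
  move=> fx; move: fG; rewrite (Adisj f g x _ _ fx Ax) ?gG// ?mem_head//.
  by rewrite inE gG orbT.
by move=> g h x gG hG; apply: Adisj; rewrite inE ?gG ?hG orbT.
Qed.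

End EsumMaps.

Lemma esum_halves (R : realType) (D : set nat) (e : R) : 0 <= e ->
  (\esum_(i in D) (e / (2 ^ i.+1)%:R)%:E <= e%:E)%E.
Proof.
move=> e0; have pos i : (0 <= (e / (2 ^ i.+1)%:R)%:E)%E.
  by rewrite lee_fin divr_ge0.
apply: (@le_trans _ _ (\esum_(i in [set: nat]) (e / (2 ^ i.+1)%:R)%:E)%E).
  exact: sub_esum.
rewrite -nneseries_esumT//.
exact: epsilon_trick0.
Qed.

(** * Finite covers by intervals *)

Section Covers.
Context {R : realType}.
Implicit Types (A B : set R) (lo hi s c r delta theta : R).

(** Admissible covers up to a constant factor in the cost.  Every member costs at
    least [lo `^ s], so only finitely many occur and the data reduce to left end
    points and lengths. *)
Definition interval_cover lo hi s c A :=
  exists l : seq (R * R),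
    [/\ forall p, p \in l -> lo <= p.2 <= hi,
        forall x, A x -> exists2 p, p \in l & p.1 <= x <= p.1 + p.2
      & \sum_(p <- l) p.2 `^ s <= c].

Lemma interval_cover_weaken lo hi s c c' A B : A `<=` B -> c <= c' ->
  interval_cover lo hi s c B -> interval_cover lo hi s c' A.
Proof.
move=> AB cc' [l [lP lB lc]]; exists l; split => //.
  by move=> x /AB/lB.
exact: le_trans cc'.
Qed.

Lemma interval_cover0 lo hi s A : A `<=` set0 -> interval_cover lo hi s 0 A.
Proof.
move=> A0; exists [::]; split => //; last by rewrite big_nil.
by move=> x /A0.
Qed.

Lemma interval_cover_lo lo lo' hi s c A : lo <= lo' ->
  interval_cover lo' hi s c A -> interval_cover lo hi s c A.
Proof.
move=> lolo [l [lP lA lc]]; exists l; split => // p /lP /andP[h ->].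
by rewrite (le_trans lolo h).
Qed.

Lemma interval_coverU lo hi s c d A B :
  interval_cover lo hi s c A -> interval_cover lo hi s d B ->
  interval_cover lo hi s (c + d) (A `|` B).
Proof.
move=> [l [lP lA lc]] [m [mP mB mc]]; exists (l ++ m); split.
- by move=> p; rewrite mem_cat => /orP[/lP|/mP].
- move=> x [/lA|/mB] [p pl px]; exists p => //; by rewrite mem_cat pl ?orbT.
- by rewrite big_cat lerD.
Qed.

Lemma interval_cover_seq (T : eqType) (X : seq T) (A : T -> set R) (w : T -> R)
    lo hi s :
  (forall x, x \in X -> interval_cover lo hi s (w x) (A x)) ->
  interval_cover lo hi s (\sum_(x <- X) w x)
    [set y | exists2 x, x \in X & A x y].
Proof.
elim: X => [_|x X IH XA].
  by rewrite big_nil; apply: interval_cover0 => y [].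
rewrite big_cons.
have h1 := XA x (mem_head _ _).
have /IH h2 : forall y, y \in X -> interval_cover lo hi s (w y) (A y).
  by move=> y yX; apply: XA; rewrite inE yX orbT.
apply: interval_cover_weaken (interval_coverU h1 h2) => //.
move=> y [z]; rewrite inE => /predU1P[->|zX] Azy; first by left.
by right; exists z.
Qed.

(** The lower bound [eta] on the weights makes [G] finite. *)
Lemma interval_cover_bigcup (T : choiceType) (G : set T) (A : T -> set R)
    (w : T -> R) lo hi s c k eta : 0 < eta -> (forall x, G x -> eta <= w x) ->
    0 <= k -> (forall x, G x -> interval_cover lo hi s (k * w x) (A x)) ->
    (\esum_(x in G) (w x)%:E <= c%:E)%E ->
  interval_cover lo hi s (k * c) (\bigcup_(x in G) A x).
Proof.
move=> eta0 Gw k0 GA Gc; have finG := esum_finite eta0 Gw Gc.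
set X := finmap.enum_fset (fset_set G).
have XG x : x \in X -> G x by rewrite in_fset_set// inE.
have hX := interval_cover_seq (fun x xX => GA _ (XG x xX)).
apply: interval_cover_weaken hX.
  by move=> y [x Gx Axy]; exists x => //; rewrite in_fset_set// inE.
rewrite -mulr_sumr ler_wpM2l//.
rewrite -lee_fin -sumEFin; apply: le_trans Gc.
by apply: esum_seq => //; exact: finmap.fset_uniq.
Qed.

Lemma interval_cover_itv lo hi s r m n : lo <= r <= hi ->
  interval_cover lo hi s (n%:R * r `^ s) [set x | m <= x < m + n%:R * r].
Proof.
move=> rP; elim: n m => [|n IH] m.
  rewrite mul0r; apply: interval_cover0 => x /=; rewrite mul0r addr0.
  by move=> /andP[/le_lt_trans] /[apply]; rewrite ltxx.
have h1 : interval_cover lo hi s (r `^ s) [set x | m <= x <= m + r].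
  exists [:: (m, r)]; split.
  - by move=> p; rewrite inE => /eqP ->.
  - by move=> x xm; exists (m, r); rewrite ?inE.
  - by rewrite big_cons big_nil addr0.
rewrite -natr1 mulrDl mul1r addrC.
apply: interval_cover_weaken (interval_coverU h1 (IH (m + r))) => //.
move=> x /=; rewrite mulrDl mul1r => /andP[mx xm].
case: (leP x (m + r)) => xr; [left|right] => /=.
  by rewrite mx.
by rewrite (ltW xr) -addrA (addrC r).
Qed.

(** A set of diameter a few times [r] is cut into intervals of length [r] rather
    than enclosed in a longer one: the lengths stay between [lo] and [hi], and
    only the cost grows. *)
Lemma interval_cover_small lo hi s r n A : 0 < r -> lo <= r <= hi ->
  (forall x y, A x -> A y -> `|x - y| <= n.+1%:R * r) ->
  interval_cover lo hi s ((3 * n.+1)%:R * r `^ s) A.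
Proof.
move=> r0 rP An; case: (pselect (A !=set0)) => [[y Ay]|A0].
  apply: interval_cover_weaken (interval_cover_itv s (y - n.+1%:R * r) (3 * n.+1) rP) => //.
  move=> x Ax /=; have := An _ _ Ax Ay.
  have : 0 < n.+1%:R * r by rewrite mulr_gt0.
  by rewrite natrM ler_norml => h /andP[h1 h2]; apply/andP; split; nra.
apply: (@interval_cover_weaken _ _ _ 0 _ _ A) => //.
  by rewrite mulr_ge0// powR_ge0.
by apply: interval_cover0 => y Ay; apply: A0; exists y.
Qed.

(** The relation need only be [rho]-Lipschitz down to the scale [lo], since no
    member of the cover is smaller.  With [rho] the Lipschitz constant of a
    contraction this transports covers between scales; with [rho = 1] it gives
    the monotonicity of the dimensions under Lipschitz images. *)
Lemma interval_cover_transfer lo hi s c rho n A B (rel : R -> R -> Prop) :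
    0 < lo -> 0 < rho ->
    (forall y, B y -> exists2 x, A x & rel x y) ->
    (forall x x' y y', rel x y -> rel x' y' ->
       `|y - y'| <= n.+1%:R * (rho * Num.max `|x - x'| lo)) ->
  interval_cover lo hi s c A ->
  interval_cover (rho * lo) (rho * hi) s ((3 * n.+1)%:R * (rho `^ s * c)) B.
Proof.
move=> lo0 rho0 relB relL [l [lP lA lc]].
pose Bp (p : R * R) := [set y | exists2 x, p.1 <= x <= p.1 + p.2 & rel x y].
pose wp (p : R * R) := (3 * n.+1)%:R * (rho * p.2) `^ s.
have h p : p \in l -> interval_cover (rho * lo) (rho * hi) s (wp p) (Bp p).
  move=> /lP /andP[lop hip].
  have p0 : 0 < p.2 := lt_le_trans lo0 lop.
  apply: interval_cover_small; first by rewrite mulr_gt0.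
    by rewrite !ler_pM2l// lop.
  move=> y y' [x xp xy] [x' xp' xy'].
  apply: le_trans (relL _ _ _ _ xy xy') _.
  rewrite !ler_pM2l// ge_max lop andbT ler_norml.
  by apply/andP; split; lra.
apply: interval_cover_weaken (interval_cover_seq h).
  move=> y /relB[x /lA[p pl px] xy]; exists p => //; by exists x.
rewrite -mulr_sumr ler_pM2l//.
apply: (@le_trans _ _ (\sum_(p <- l) rho `^ s * p.2 `^ s)).
  rewrite le_eqVlt; apply/orP; left; apply/eqP.
  rewrite big_seq [RHS]big_seq; apply: eq_bigr => p /lP /andP[lop _].
  by rewrite powRM ?ltW// (lt_le_trans lo0 lop).
by rewrite -mulr_sumr ler_wpM2l// powR_ge0.
Qed.

End Covers.

(** * Dimensions in terms of interval covers *)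

Section Dimension.
Context {R : realType}.
Implicit Types (A B E F : set R) (lo hi s c r delta theta : R).

Lemma diam_ge A x y : A x -> A y -> (`|x - y|%:E <= diam A)%E.
Proof. by move=> Ax Ay; apply: ereal_sup_ubound; right; exists x => //; exists y. Qed.

Lemma diam_le A r : 0 <= r -> (forall x y, A x -> A y -> `|x - y| <= r) ->
  (diam A <= r%:E)%E.
Proof.
move=> r0 Ar; apply: ge_ereal_sup => _ [->|[x Ax [y Ay] <-]].
  by rewrite lee_fin.
by rewrite lee_fin; exact: Ar.
Qed.

Lemma diam_ge0 A : (0 <= diam A)%E.
Proof. by apply: ereal_sup_ubound; left. Qed.

Lemma diam_itv m r : 0 <= r -> diam [set x | m <= x <= m + r] = r%:E.
Proof.
move=> r0; apply/eqP; rewrite eq_le; apply/andP; split.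
  apply: diam_le => // x y /= xm ym; rewrite ler_norml; apply/andP; split; lra.
have -> : r%:E = `|(m + r) - m|%:E by rewrite addrAC subrr add0r ger0_norm.
by apply: diam_ge => /=; rewrite ?lexx ?lerDl ?r0.
Qed.

Lemma diam_fine A r : (diam A <= r%:E)%E -> diam A = (fine (diam A))%:E.
Proof.
move=> Ar; rewrite fineK// ge0_fin_numE ?diam_ge0//.
by apply: le_lt_trans Ar _; rewrite ltry.
Qed.

(** A set of diameter [r] lies in the interval of radius [r] around any of its
    points; three intervals of length [r] cover it. *)
Lemma admissible_interval_cover theta s eps delta E : 0 <= s -> 0 < delta ->
  admissible_cover theta s eps delta E ->
  interval_cover (delta `^ theta^-1) delta s (3 * eps) E.
Proof.
move=> s0 d0 [D [U [EU DU sumU]]].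
have lo0 : 0 < delta `^ theta^-1 by rewrite powR_gt0.
have fU i : D i -> diam (U i) = (fine (diam (U i)))%:E.
  by move=> /DU[_]; exact: diam_fine.
have DU' i : D i -> delta `^ theta^-1 <= fine (diam (U i)) <= delta.
  by move=> Di; have [] := DU i Di; rewrite fU// !lee_fin => -> ->.
apply: interval_cover_weaken EU (lexx _) _.
apply: (@interval_cover_bigcup _ _ D U (fun i => fine (diam (U i)) `^ s) _ _ _ _ _
  ((delta `^ theta^-1) `^ s)) => //.
- by rewrite powR_gt0.
- move=> i Di; have /andP[h _] := DU' i Di.
  by apply: ge0_ler_powR; rewrite // nnegrE ?ltW// (lt_le_trans lo0 h).
- move=> i Di; have /andP[h1 h2] := DU' i Di.
  apply: (@interval_cover_small _ _ _ _ _ 0); rewrite ?h1 ?(lt_le_trans lo0 h1)//.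
  by move=> x y Ux Uy; rewrite mul1r -lee_fin -fU//; exact: diam_ge.
- apply: le_trans sumU; apply: le_esum => i Di.
  by rewrite fU//= poweR_EFin.
Qed.

Lemma interval_cover_admissible theta s eps delta E : 0 < delta ->
  interval_cover (delta `^ theta^-1) delta s eps E ->
  admissible_cover theta s eps delta E.
Proof.
move=> d0 [l [lP lE lc]].
have lo0 : 0 < delta `^ theta^-1 by rewrite powR_gt0.
pose p i := nth (0, 0) l i.
have pP i : (i < size l)%N -> delta `^ theta^-1 <= (p i).2 <= delta.
  by move=> il; apply: lP; exact: mem_nth.
have dU i : (i < size l)%N ->
    diam [set x | (p i).1 <= x <= (p i).1 + (p i).2] = (p i).2%:E.
  by move=> /pP/andP[h _]; rewrite diam_itv// ltW// (lt_le_trans lo0 h).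
exists [set i | (i < size l)%N], (fun i => [set x | (p i).1 <= x <= (p i).1 + (p i).2]).
split.
- move=> x /lE[q ql qx]; exists (index q l); rewrite /= ?index_mem//.
  by rewrite /p nth_index.
- by move=> i /= il; rewrite dU// !lee_fin; apply/andP; exact: pP.
- apply: esum_le_seq => I uI Il.
  apply: (@le_trans _ _ (\sum_(i <- I) ((p i).2 `^ s)%:E)%E).
    rewrite big_seq [leRHS]big_seq; apply: lee_sum => i /Il /= il.
    by rewrite dU.
  rewrite sumEFin lee_fin; apply: le_trans lc.
  rewrite [leRHS](big_nth (0,0)) big_mkord -(big_mkord xpredT (fun i => (p i).2 `^ s)).
  rewrite -lee_fin -!sumEFin.
  have := @esum_seq R nat [set` (index_iota 0 (size l))] (fun i => ((p i).2 `^ s)%:E) I uI.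
  rewrite esum_fset//; last by move=> i _; rewrite lee_fin powR_ge0.
  rewrite -fsbig_seq ?iota_uniq//; last by apply => x /Il /=; rewrite mem_index_iota.
exact: finite_seq.
Qed.

(** An admissible cover at scale [delta] is a competitor in the Hausdorff
    premeasure at every scale above [delta]. *)
Lemma hausdorff_le_lower_dim theta E : (hausdorff_dim E <= lower_dim theta E)%E.
Proof.
rewrite /lower_dim; case: ifPn => // _; apply: ereal_inf_le_tmp.
move=> _ [s [s0 sE] <-]; exists s => //; split => //.
apply/eqP; rewrite eq_le; apply/andP; split.
  apply: ge_ereal_sup => _ [d /= d0 <-]; apply/lee_addgt0Pr => e e0.
  have [|delta [/andP[de0 de1] [D [U [EU DU sumU]]]]] := sE e (Num.min d 1) e0.
    by rewrite lt_min d0 ltr01 ge_min lexx orbT.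
  rewrite add0e; apply: ge_ereal_inf; exists (cover_sum s D U) => //.
  exists D, U; split=> // i Di; have [_ /le_trans] := DU i Di; apply.
  by rewrite lee_fin; move: de1; rewrite lt_min => /andP[/ltW].
apply: le_trans (ereal_sup_ubound _); last by exists 1 => /=.
apply: le_ereal_inf_tmp => _ [D [U [_ _ ->]]].
by apply: esum_ge0 => i _; exact: poweR_ge0.
Qed.

Lemma lower_le_upper_dim theta E : (lower_dim theta E <= upper_dim theta E)%E.
Proof.
rewrite /lower_dim /upper_dim; case: ifPn => // _; apply: ereal_inf_le_tmp.
move=> _ [s [s0 sE] <-]; exists s => //; split => // e d0 e0 /andP[d00 d01].
have [d [/andP[d_0 d1] dE]] := sE e e0.
have m0 : 0 < Num.min d d0 by rewrite lt_min d_0.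
have m2 : Num.min d d0 / 2 < Num.min d d0 by lra.
exists (Num.min d d0 / 2); split.
  by rewrite divr_gt0//= (lt_le_trans m2)// ge_min lexx orbT.
by apply: dE; rewrite divr_gt0//= (lt_le_trans m2)// ge_min lexx.
Qed.

Lemma hausdorff_le_upper_dim theta (A : set R) : (hausdorff_dim A <= upper_dim theta A)%E.
Proof. exact: le_trans (hausdorff_le_lower_dim _ _) (lower_le_upper_dim _ _). Qed.

Lemma hausdorff_dim_ge0 E : (0 <= hausdorff_dim E)%E.
Proof. by apply: le_ereal_inf_tmp => _ [s [s0 _] <-]; rewrite lee_fin. Qed.

Lemma upper_dim0 (A : set R) : upper_dim 0 A = hausdorff_dim A.
Proof. by rewrite /upper_dim eqxx. Qed.

Lemma lower_dim0 (A : set R) : lower_dim 0 A = hausdorff_dim A.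
Proof. by rewrite /lower_dim eqxx. Qed.

(** The factor [k] disappears because the cost has to be small for every bound. *)
Lemma dim_transfer theta k E F : 0 < theta -> 0 < k ->
    (forall lo hi s c, 0 < lo -> interval_cover lo hi s c F ->
      interval_cover lo hi s (k * c) E) ->
  (lower_dim theta E <= lower_dim theta F)%E /\
  (upper_dim theta E <= upper_dim theta F)%E.
Proof.
move=> t0 k0 FE; rewrite /lower_dim /upper_dim gt_eqF//.
have step s e d : 0 <= s -> 0 < d -> admissible_cover theta s (e / (3 * k)) d F ->
    admissible_cover theta s e d E.
  move=> s0 d0 /(admissible_interval_cover s0 d0) h.
  apply: interval_cover_admissible => //.
  apply: interval_cover_weaken (FE _ _ _ _ _ h) => //; last by rewrite powR_gt0.
  rewrite [leLHS](_ : _ = e)//; field; lra.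
split; apply: ereal_inf_le_tmp => _ [s [s0 sE] <-]; exists s => //; split => // e.
  move=> d e0 d0; have [|d' [/andP[d'0 d'1] dF]] := sE (e / (3 * k)) d _ d0.
    by rewrite divr_gt0// mulr_gt0.
  by exists d'; rewrite d'0; split => //; exact: step.
move=> e0; have [|d [d0 dF]] := sE (e / (3 * k)).
  by rewrite divr_gt0// mulr_gt0.
by exists d; split => // d' d'P; apply: step (dF _ d'P) => //; case/andP: d'P.
Qed.

(** A bounded cost at exponent [s] becomes arbitrarily small at exponent [s + e],
    since all lengths are at most [delta]. *)
Lemma upper_dim_le theta s c E : 0 < theta -> 0 <= s -> 0 <= c ->
    (forall delta, 0 < delta < 1 ->
      interval_cover (delta `^ theta^-1) delta s c E) ->
  (upper_dim theta E <= s%:E)%E.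
Proof.
move=> t0 s0 c0 cE; apply/lee_addgt0Pr => e e0; rewrite -EFinD /upper_dim gt_eqF//.
apply: ge_ereal_inf; exists (s + e)%:E => //; exists (s + e) => //.
split; first by lra.
move=> eps eps0; have q0 : 0 < eps / (c + 1) by rewrite divr_gt0//; lra.
(* this threshold makes [d `^ e * c <= eps] for [d < d0] *)
pose d0 := Num.min 1 ((eps / (c + 1)) `^ e^-1).
exists d0; split; first by rewrite lt_min ltr01 powR_gt0//= ge_min lexx.
move=> d /andP[d_0]; rewrite lt_min => /andP[d1 de].
apply: interval_cover_admissible => //.
have [|l [lP lE lc]] := cE d; first by rewrite d_0.
exists l; split => //.
have dec : d `^ e * c <= eps.
  have : d `^ e <= eps / (c + 1).
    apply: (@le_trans _ _ (((eps / (c + 1)) `^ e^-1) `^ e)).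
      by apply: ge0_ler_powR; rewrite ?nnegrE ?powR_ge0 ?ltW.
    by rewrite -powRrM mulVf ?gt_eqF// powRr1// ltW.
  move=> h; apply: (@le_trans _ _ (eps / (c + 1) * c)).
    by rewrite ler_wpM2r.
  by rewrite mulrAC ler_pdivrMr ?ler_wpM2l//; lra.
apply: le_trans dec; apply: (@le_trans _ _ (d `^ e * \sum_(p <- l) p.2 `^ s)).
  rewrite mulr_sumr big_seq [leRHS]big_seq; apply: ler_sum => p /lP /andP[pl ph].
  have p0 : 0 < p.2 by apply: lt_le_trans pl; rewrite powR_gt0.
  rewrite powRD; last by rewrite (gt_eqF p0) implybT.
  rewrite mulrC ler_wpM2r ?powR_ge0//.
  by apply: ge0_ler_powR => //; rewrite ?nnegrE; exact: ltW.
by rewrite ler_wpM2l// powR_ge0.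
Qed.

(** For scales bounded away from 0 the unit interval is covered by a fixed number
    of intervals of length [delta], which extends the bound to all scales. *)
Lemma upper_dim_lt theta s E : 0 < theta <= 1 -> E `<=` `[0, 1] ->
    (upper_dim theta E < s%:E)%E ->
  exists2 c, 0 <= c & forall delta, 0 < delta < 1 ->
    interval_cover (delta `^ theta^-1) delta s c E.
Proof.
move=> /andP[t0 t1] E01; rewrite /upper_dim gt_eqF//.
move=> /ereal_inf_ltP[_ [s' [s'0 s'E] <-]]; rewrite lte_fin => s's.
have [d0 [/andP[d00 d01] d0E]] := s'E 1 ltr01.
have [n nd0] : exists n, 1 < n%:R * d0.
  by exists (Num.bound d0^-1); rewrite -ltr_pdivrMr// mul1r unstable.ltr_bound.
exists (3 + n%:R); first by rewrite addr_ge0.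
move=> d /andP[d_0 d_1]; have [dd0|dd0] := ltP d d0.
  have := d0E d; rewrite d_0 dd0 => /(_ isT) /(admissible_interval_cover s'0 d_0).
  move=> [l [lP lE lc]]; exists l; split => //.
  apply: (@le_trans _ _ (3 * 1)); last by rewrite mulr1 lerDl.
  apply: le_trans lc; rewrite big_seq [leRHS]big_seq; apply: ler_sum => p /lP.
  move=> /andP[h1 h2]; apply: ger_powR; last exact: ltW.
  by rewrite (lt_le_trans _ h1) ?powR_gt0//= (le_trans h2)// ltW.
have hd : d `^ theta^-1 <= d <= d.
  by rewrite lexx andbT ge1r_powR ?invf_ge1// d_0 ltW.
apply: interval_cover_weaken (interval_cover_itv s 0 n hd).
  move=> x /E01; rewrite /= in_itv/= => /andP[-> x1]; rewrite add0r.
  apply: le_lt_trans x1 _; apply: lt_le_trans nd0 _.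
  by rewrite ler_wpM2l.
rewrite (@le_trans _ _ (n%:R * 1))//; last by rewrite mulr1 lerDr.
rewrite ler_wpM2l// -(powRr0 d); apply: ger_powR; first by rewrite d_0 ltW.
exact/ltW/(le_lt_trans s'0).
Qed.

End Dimension.

(** * Continued fractions *)

Section ContinuedFraction.
Context {R : realType}.
Implicit Types (I : set nat) (A : set R) (x y : R).

Lemma cf_map01 b x : (0 < b)%N -> 0 <= x <= 1 -> 0 < cf_map b x <= 1.
Proof.
move=> b0 /andP[x0 x1]; have b1 : (1 : R) <= b%:R by rewrite ler1n.
have bx : 0 < b%:R + x by lra.
by rewrite /cf_map invr_gt0 invf_le1 bx//=; lra.
Qed.

(** [cf_map 1] has derivative -1 at 0, so uniform contraction needs two steps. *)
Lemma cf_map2_contract b c x y : (0 < b)%N -> (0 < c)%N ->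
    0 <= x <= 1 -> 0 <= y <= 1 ->
  `|cf_map b (cf_map c x) - cf_map b (cf_map c y)| <= `|x - y| / 4.
Proof.
move=> b0 c0 /andP[x0 x1] /andP[y0 y1].
have b1 : (1 : R) <= b%:R by rewrite ler1n.
have c1 : (1 : R) <= c%:R by rewrite ler1n.
rewrite /cf_map; set B : R := b%:R; set C : R := c%:R.
have hx : 2 <= B * (C + x) + 1 by rewrite /B /C; nra.
have hy : 2 <= B * (C + y) + 1 by rewrite /B /C; nra.
have -> : (B + (C + x)^-1)^-1 - (B + (C + y)^-1)^-1 =
    (x - y) / ((B * (C + x) + 1) * (B * (C + y) + 1)).
  by field; rewrite -/B -/C; repeat (apply/andP; split); rewrite gt_eqF// /B /C; nra.
rewrite normrM ler_wpM2l// normfV.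
have h : 4 <= (B * (C + x) + 1) * (B * (C + y) + 1) by nra.
by rewrite ger0_norm ?lef_pV2 ?posrE//; lra.
Qed.

Lemma convergent01 (b : nat -> nat) n : (forall k, (0 < b k)%N) ->
  0 <= (convergent b n : R) <= 1.
Proof.
elim: n b => [|n IH] b b0 /=; first by rewrite lexx ler01.
have /andP[/ltW -> ->] := cf_map01 (b0 0) (IH (fun k => b k.+1) (fun k => b0 k.+1)).
by [].
Qed.

Lemma convergent_near (b : nat -> nat) (y : nat -> R) n :
    (forall k, (0 < b k)%N) -> (forall k, 0 <= y k <= 1) ->
    (forall k, y k = cf_map (b k) (y k.+1)) ->
  `|y 0%N - convergent b n| <= 2 * 2^-1 ^+ n.
Proof.
suff H : forall n b (y : nat -> R), (forall k, (0 < b k)%N) -> (forall k, 0 <= y k <= 1) ->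
    (forall k, y k = cf_map (b k) (y k.+1)) ->
    `|y 0%N - convergent b n| <= 2 * 2^-1 ^+ n /\
    `|y 0%N - convergent b n.+1| <= 2 * 2^-1 ^+ n.+1.
  by move=> b0 y01 yS; have [] := H n b y b0 y01 yS.
elim=> [|{}n IH] {}b {}y b0 y01 yS.
  have := y01 0%N; have := convergent01 1 b0.
  move=> /andP[h1 h2] /andP[h3 h4]; rewrite subr0 expr0 expr1.
  by split; rewrite ler_norml; apply/andP; split; lra.
split; first by have [] := IH b y b0 y01 yS.
have [h _] := IH (fun k => b k.+2) (fun k => y k.+2) (fun k => b0 _)
  (fun k => y01 _) (fun k => yS _).
rewrite yS yS.
apply: (@le_trans _ _ (`|y 2%N - convergent (fun k => b k.+2) n| / 4)).
  by apply: cf_map2_contract => //; exact: convergent01.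
by rewrite !exprS; lra.
Qed.

Lemma cf_set01 I x : cf_set R I x -> 0 <= x <= 1.
Proof. by case=> /andP[/ltW -> /ltW ->]. Qed.

(** The tails of the convergents converge as well, because inverting one step of
    the continued fraction is continuous at a nonzero limit. *)
Lemma cf_set_unfold I x : I `<=` posnat -> cf_set R I x ->
  exists2 b, I b & exists2 y, cf_set R I y & x = cf_map b y.
Proof.
move=> I0 [/andP[x0 x1] xirr [b [bI bx]]]; exists (b 0%N) => //.
have b0 k : (0 < b k)%N by exact/I0/bI.
set y := x^-1 - (b 0%N)%:R.
have xy : x = cf_map (b 0%N) y by rewrite /cf_map /y addrC subrK invrK.
have by_ : convergent (fun k => b k.+1) n @[n --> \oo] --> y.
  have /(cvgV (lt0r_neq0 x0)) h : convergent b n.+1 @[n --> \oo] --> x.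
    by rewrite cvg_shiftS.
  rewrite (_ : convergent _ =
    fun n => (convergent b n.+1)^-1 - (b 0%N)%:R :> R); last first.
    by apply/funext => n /=; rewrite invrK addrAC subrr add0r.
  exact: cvgB h (cvg_cst _).
have y01 : 0 <= y <= 1.
  have bn n := convergent01 n (fun k => b0 k.+1).
  apply/andP; split.
    by apply: (cvgr_to_ge by_); apply: nearW => n; case/andP: (bn n).
  by apply: (cvgr_to_le by_); apply: nearW => n; case/andP: (bn n).
have yirr : irrational y.
  move=> [r _ ry]; apply: xirr; exists (r + (b 0%N)%:R)^-1 => //.
  by rewrite xy /cf_map fmorphV rmorphD /= ry ratr_nat addrC.
have [y0 y1] : y <> 0 /\ y <> 1.
  split=> y_; apply: yirr; rewrite y_.
    by exists 0 => //; rewrite rmorph0.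
  by exists 1 => //; rewrite rmorph1.
exists y => //; split => //.
  by move: y01; rewrite !le_eqVlt eq_sym => /andP[/predU1P[//|->] /predU1P[//|->]].
by exists (fun k => b k.+1).
Qed.

Lemma pos_rationalE x : 0 < x -> rational x ->
  exists p q : nat, (0 < q)%N /\ x = p%:R / q%:R.
Proof.
move=> x0 [r _ rx]; exists `|numq r|%N, `|denq r|%N.
split; first by rewrite absz_gt0 denq_eq0.
have r0 : 0 < r by rewrite -(ltr0q R) rx.
rewrite -rx {1}/ratr; congr (_ / _).
  by rewrite -[in LHS](@gez0_abs (numq r)) ?numq_ge0 ?ltW.
by rewrite -[in LHS](@gez0_abs (denq r)) ?ltW.
Qed.

Section Coinduction.
Variables (I : set nat) (A : set R).
Hypothesis I0 : I `<=` posnat.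
Hypothesis A01 : forall x, A x -> 0 <= x <= 1.
Hypothesis Acf : forall x, A x ->
  exists2 b, I b & exists2 y, A y & x = cf_map b y.

Let coind_itv x : A x -> 0 < x < 1.
Proof.
move=> /Acf[b /I0 b0 [y /Acf[c /I0 c0 [z /A01 z01 ->]] ->]].
have b1 : (1 : R) <= b%:R by rewrite ler1n.
have /andP[h1 h2] := cf_map01 c0 z01.
have bx : 1 < b%:R + cf_map c z by lra.
have bx0 : 0 < b%:R + cf_map c z by lra.
by rewrite /cf_map invr_gt0 invf_lt1 bx0.
Qed.

Let coind_irrational x : A x -> irrational x.
Proof.
move=> Ax rx; have /andP[x0 _] := coind_itv Ax.
have [p [q [q0 xpq]]] := pos_rationalE x0 rx.
elim/ltn_ind: q p x Ax {rx} x0 q0 xpq => q IH p x Ax x0 q0 xpq.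
have q0' : (0 : R) < q%:R by rewrite ltr0n.
have /andP[_ x1] := coind_itv Ax.
have pq : (p < q)%N by move: x1; rewrite xpq ltr_pdivrMr// mul1r ltr_nat.
have p0 : (0 < p)%N by move: x0; rewrite xpq pmulr_lgt0 ?invr_gt0// ltr0n.
have p0' : (0 : R) < p%:R by rewrite ltr0n.
have [b Ib [y Ay xy]] := Acf Ax.
have /andP[y0 _] := coind_itv Ay.
have yE : y = x^-1 - b%:R by rewrite xy /cf_map invrK addrAC subrr add0r.
have bpq : (b * p <= q)%N.
  rewrite -(ler_nat R) natrM -ler_pdivlMr//.
  by move: y0; rewrite yE xpq invf_div subr_gt0 => /ltW.
apply: (IH p pq (q - b * p)%N y Ay y0 p0).
rewrite yE xpq invf_div natrB// natrM; field; exact: lt0r_neq0.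
Qed.

(** A coinduction principle: digits are read off by choosing a predecessor again
    and again, the convergents of these digits converge by contraction, and the
    irrationality is an infinite descent on denominators, [p / q] having
    predecessor [(q - b p) / p]. *)
Lemma cf_set_coind : A `<=` cf_set R I.
Proof.
move=> x Ax; split; [exact: coind_itv|exact: coind_irrational|].
have /choice[nx nxP] : forall z, exists q : nat * R,
    A z -> [/\ I q.1, A q.2 & z = cf_map q.1 q.2].
  move=> z; case: (pselect (A z)) => [/Acf[b Ib [y Ay zy]]|nA].
    by exists (b, y).
  by exists (0%N, 0).
pose y n := iter n (fun z => (nx z).2) x; pose b n := (nx (y n)).1.
have Ay n : A (y n) by elim: n => // n /nxP[].
have bI n : I (b n) by have [] := nxP _ (Ay n).
exists b; split => //; apply/cvgrPdist_le => e e0.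
have := @cvg_geometric R 2 2^-1.
rewrite ger0_norm ?invr_ge0// invf_lt1// ltr1n => /(_ isT) /cvgrPdist_le /(_ e e0).
apply: filterS => n; rewrite sub0r normrN /= ger0_norm; last first.
  by rewrite mulr_ge0// exprn_ge0// invr_ge0.
apply: le_trans; apply: (convergent_near (y := y)) => [k|k|k].
- exact/I0/bI.
- exact/A01/Ay.
- by have [] := nxP _ (Ay k).
Qed.

End Coinduction.
End ContinuedFraction.

(** * Compositions of the system: bounded distortion *)

Section Compositions.
Context {R : realType}.
Implicit Types (I : set nat) (S : set (R -> R)) (f g : R -> R).

Lemma compositions_cat S m n f g : compositions S m f -> compositions S n g ->
  compositions S (m + n) (f \o g).
Proof.
elim: m f => [|m IH] f /=; first by move=> ->.
move=> [f1 Sf1 [f2 Sf2 <-]] Sg; exists f1 => //; exists (f2 \o g) => //.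
exact: IH.
Qed.

Lemma compositions1 S f : S f -> compositions S 1 f.
Proof. by move=> Sf; exists f => //; exists idfun. Qed.

(** In both cases every member of the system is written through [cf_map], with
    the digit 1 never standing alone. *)
Lemma cf_ifs_cases I f : I `<=` posnat -> cf_ifs I f ->
  (exists2 b, I b & (1 < b)%N /\ f = cf_map b) \/
  (I 1%N /\ exists2 b, I b & (0 < b)%N /\ f = cf_map 1 \o cf_map b).
Proof.
move=> I0 [[nI1 [b Ib ->]]|[I1 [[b [Ib b1] ->]|[b Ib ->]]]].
- left; exists b => //; split => //; have := I0 _ Ib; rewrite /posnat /=.
  by case: b Ib => [|[|b]].
- left; exists b => //; split => //; have := I0 _ Ib; rewrite /posnat /=.
  by case: b Ib b1 => [|[|b]].
- by right; split => //; exists b => //; split => //; exact: I0.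
Qed.

(** The inequality [p' + q' <= p + q] is there for induction: prepending the digit
    [b] replaces [(q, q')] by [(b q + p, b q' + p')], and the order of these two
    does not follow from [q' <= q] alone. *)
Definition moebius f := exists p p' q q' : R,
  [/\ [/\ 0 <= p, 0 <= p', 0 <= q' <= q & 1 <= q],
      p' + q' <= p + q, `|p * q' - p' * q| = 1
    & forall x, 0 <= x <= 1 -> f x = (p + p' * x) / (q + q' * x)].

Lemma moebius_id : moebius idfun.
Proof.
exists 0, 1, 1, 0; split; [by split; lra|by lra| |].
  by rewrite mulr0 mulr1 sub0r normrN normr1.
by move=> x _ /=; field.
Qed.

Lemma moebius_cf_map b f : (0 < b)%N -> moebius f -> moebius (cf_map b \o f).
Proof.
move=> b0 [p [p' [q [q' [[p0 p'0 /andP[q'0 qq'] q1] pq det fE]]]]].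
have b1 : (1 : R) <= b%:R by rewrite ler1n.
have hb : 0 <= (b%:R - 1) * (q - q') by rewrite mulr_ge0//; lra.
have hq' : 0 <= (b%:R - 1) * q' by rewrite mulr_ge0//; lra.
exists q, q', (b%:R * q + p), (b%:R * q' + p'); split.
- by split; [lra|lra|apply/andP; split; lra|lra].
- by lra.
- by rewrite -det -normrN; congr `|_|; ring.
move=> x x01; have /andP[x0 x1] := x01.
rewrite /= /cf_map (fE x x01); field.
by apply/andP; split; rewrite gt_eqF//; nra.
Qed.

Lemma compositions_moebius I n f : I `<=` posnat ->
  compositions (cf_ifs I) n f -> moebius f.
Proof.
move=> I0; elim: n f => [f ->|n IH _ [f If [g /IH mg <-]]].
  exact: moebius_id.
case: (cf_ifs_cases I0 If) => [[b _ [b1 ->]]|[_ [b _ [b0 ->]]]].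
  by apply: moebius_cf_map => //; exact: ltn_trans b1.
by apply: (@moebius_cf_map 1) => //; exact: moebius_cf_map.
Qed.

(** The difference quotient at [x], [y] is the inverse of
    [(q + q' x) (q + q' y)], which lies between [q ^+ 2] and [4 * q ^+ 2]. *)
Lemma moebius_distortion f : moebius f -> exists2 k, 0 < k &
  forall x y, 0 <= x <= 1 -> 0 <= y <= 1 ->
    k / 4 * `|x - y| <= `|f x - f y| <= k * `|x - y|.
Proof.
move=> [p [p' [q [q' [[p0 p'0 /andP[q'0 qq'] q1] pq det fE]]]]].
have q0 : 0 < q by lra.
exists (q ^+ 2)^-1; first by rewrite invr_gt0 exprn_gt0.
move=> x y x01 y01; rewrite (fE x x01) (fE y y01).
have /andP[x0 x1] := x01; have /andP[y0 y1] := y01.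
have [hx hx2] : q <= q + q' * x /\ q + q' * x <= 2 * q by split; nra.
have [hy hy2] : q <= q + q' * y /\ q + q' * y <= 2 * q by split; nra.
set u := q + q' * x in hx hx2 *; set v := q + q' * y in hy hy2 *.
have -> : (p + p' * x) / u - (p + p' * y) / v =
   (p * q' - p' * q) * (y - x) / (u * v).
  by rewrite /u /v; field; rewrite -/u -/v; apply/andP; split; rewrite gt_eqF//; lra.
have uv1 : q ^+ 2 <= u * v by rewrite expr2 ler_pM// ltW.
have uv2 : u * v <= 4 * q ^+ 2.
  have -> : 4 * q ^+ 2 = (2 * q) * (2 * q) by ring.
  by rewrite ler_pM//; lra.
have q20 : 0 < q ^+ 2 by rewrite exprn_gt0.
have uv0 : 0 < u * v by exact: lt_le_trans uv1.
rewrite normrM normfV normrM det mul1r [`|y - x|]distrC (gtr0_norm uv0).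
rewrite -invfM ![_^-1 * _]mulrC.
by apply/andP; split; rewrite ler_wpM2l// lef_pV2 ?posrE//; lra.
Qed.

Lemma cf_ifs01 I f x : I `<=` posnat -> cf_ifs I f -> 0 <= x <= 1 -> 0 <= f x <= 1.
Proof.
move=> I0 If x01; case: (cf_ifs_cases I0 If) => [[b _ [b1 ->]]|[_ [b _ [b0 ->]]]].
  by have /andP[/ltW -> ->] := cf_map01 (ltnW b1) x01.
have /andP[/ltW h1 h2] := cf_map01 b0 x01.
have h : 0 <= cf_map b x <= 1 by rewrite h1 h2.
by have /andP[/ltW -> ->] := cf_map01 (ltn0Sn 0) h.
Qed.

Lemma compositions01 I n f x : I `<=` posnat -> compositions (cf_ifs I) n f ->
  0 <= x <= 1 -> 0 <= f x <= 1.
Proof.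
move=> I0; elim: n f => [f -> //|n IH _ [f If [g Ig <-]]] x01 /=.
exact/(cf_ifs01 I0 If)/IH.
Qed.

Lemma cf_ifs_contract I f x y : I `<=` posnat -> cf_ifs I f ->
  0 <= x <= 1 -> 0 <= y <= 1 -> `|f x - f y| <= 4^-1 * `|x - y|.
Proof.
move=> I0 If x01 y01; case: (cf_ifs_cases I0 If) => [[b _ [b1 ->]]|[_ [b _ [b0 ->]]]].
  have b2 : (2 : R) <= b%:R by rewrite ler_nat.
  case/andP: x01 => x0 x1; case/andP: y01 => y0 y1.
  have -> : cf_map b x - cf_map b y = (y - x) / ((b%:R + x) * (b%:R + y)).
    by rewrite /cf_map; field; apply/andP; split; rewrite gt_eqF//; lra.
  have h : 4 <= (b%:R + x) * (b%:R + y) by nra.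
  rewrite normrM [`|y - x|]distrC mulrC ler_wpM2r// normfV ger0_norm; last lra.
  by rewrite lef_pV2 ?posrE//; lra.
by rewrite mulrC; apply: cf_map2_contract.
Qed.

Lemma cf_map_surj b (y : R) : exists x, cf_map b x = y.
Proof. by exists (y^-1 - b%:R); rewrite /cf_map addrC subrK invrK. Qed.

(** With the convention that 0 is its own inverse, [cf_map b] is a bijection of the
    whole line; this makes composition on the right cancellable. *)
Lemma compositions_surj I n f (y : R) : I `<=` posnat ->
  compositions (cf_ifs I) n f -> exists x, f x = y.
Proof.
move=> I0; elim: n f y => [f y ->|n IH _ y [f If [g Ig <-]]]; first by exists y.
suff [z fz] : exists z, f z = y by have [x gx] := IH g z Ig; exists x => /=; rewrite gx.
case: (cf_ifs_cases I0 If) => [[b _ [b1 ->]]|[_ [b _ [b0 ->]]]].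
  exact: cf_map_surj.
have [z zy] := cf_map_surj 1 y; have [w wz] := cf_map_surj b z.
by exists w; rewrite /= wz.
Qed.

Lemma lipschitz_const_ge0 f : (0 <= lipschitz_const f)%E.
Proof. by apply: le_ereal_inf_tmp => _ [k [k0 _] <-]; rewrite lee_fin. Qed.

Lemma lipschitz_const_le f k : 0 <= k ->
  (forall x y, 0 <= x <= 1 -> 0 <= y <= 1 -> `|f x - f y| <= k * `|x - y|) ->
  (lipschitz_const f <= k%:E)%E.
Proof.
move=> k0 fk; apply: ge_ereal_inf; exists k%:E => //; exists k => //; split => //.
by move=> [x y] /= []; rewrite !in_itv /=; exact: fk.
Qed.

Definition lip f : R := fine (lipschitz_const f).

Lemma lipE f k : 0 <= k ->
  (forall x y, 0 <= x <= 1 -> 0 <= y <= 1 -> `|f x - f y| <= k * `|x - y|) ->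
  lipschitz_const f = (lip f)%:E.
Proof.
move=> k0 fk; rewrite /lip fineK// ge0_fin_numE ?lipschitz_const_ge0//.
by apply: le_lt_trans (lipschitz_const_le k0 fk) _; rewrite ltry.
Qed.

Lemma lip_le f k : 0 <= k ->
  (forall x y, 0 <= x <= 1 -> 0 <= y <= 1 -> `|f x - f y| <= k * `|x - y|) ->
  lip f <= k.
Proof.
by move=> k0 fk; rewrite -lee_fin -(lipE k0 fk); exact: lipschitz_const_le.
Qed.

Lemma lip_dist f k x y : 0 <= k ->
  (forall x y, 0 <= x <= 1 -> 0 <= y <= 1 -> `|f x - f y| <= k * `|x - y|) ->
  0 <= x <= 1 -> 0 <= y <= 1 -> `|f x - f y| <= lip f * `|x - y|.
Proof.
move=> k0 fk x01 y01; have [->|xy] := eqVneq x y.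
  by rewrite !subrr normr0 mulr0.
have xy0 : 0 < `|x - y| by rewrite normr_gt0 subr_eq0.
rewrite -ler_pdivrMr// -lee_fin -(lipE k0 fk).
apply: le_ereal_inf_tmp => _ [l [l0 fl] <-].
by rewrite lee_fin ler_pdivrMr//; apply: (fl (x, y)); rewrite /= !in_itv.
Qed.

Section Lip.
Variables (I : set nat) (I0 : I `<=` posnat).

Let dist_mono (k k' x y : R) : k <= k' -> k * `|x - y| <= k' * `|x - y|.
Proof. by move=> kk; rewrite ler_wpM2r. Qed.

Lemma lip_compositionsE n f : compositions (cf_ifs I) n f ->
  lipschitz_const f = (lip f)%:E.
Proof.
move=> /(compositions_moebius I0) /moebius_distortion[k k0 fk].
by apply: (@lipE _ k) => [|x y x01 y01]; [exact: ltW|case/andP: (fk x y x01 y01)].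
Qed.

Lemma compositions_lip n f x y : compositions (cf_ifs I) n f ->
  0 <= x <= 1 -> 0 <= y <= 1 ->
  lip f / 4 * `|x - y| <= `|f x - f y| <= lip f * `|x - y|.
Proof.
move=> /(compositions_moebius I0) /moebius_distortion[k k0 fk] x01 y01.
have h x' y' (x'01 : 0 <= x' <= 1) (y'01 : 0 <= y' <= 1) :
  `|f x' - f y'| <= k * `|x' - y'| by case/andP: (fk x' y' x'01 y'01).
rewrite (lip_dist (ltW k0) h)// andbT.
have /andP[+ _] := fk x y x01 y01; apply: le_trans.
by apply: dist_mono; rewrite ler_pM2r// (lip_le (ltW k0)).
Qed.

Lemma lip_gt0 n f : compositions (cf_ifs I) n f -> 0 < lip f.
Proof.
move=> If; have /moebius_distortion[k k0 fk] := compositions_moebius I0 If.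
have h0 : 0 <= (0 : R) <= 1 by rewrite lexx ler01.
have h1 : 0 <= (1 : R) <= 1 by rewrite lexx ler01.
have /andP[_] := compositions_lip If h1 h0; have /andP[+ _] := fk 1 0 h1 h0.
by rewrite subr0 normr1 !mulr1; lra.
Qed.

Lemma lip_comp_le m n f g :
  compositions (cf_ifs I) m f -> compositions (cf_ifs I) n g ->
  lip (f \o g) <= lip f * lip g.
Proof.
move=> If Ig; apply: lip_le => [|x y x01 y01].
  by rewrite mulr_ge0// ltW// (lip_gt0 If, lip_gt0 Ig).
have /andP[_ h1] := compositions_lip If (compositions01 I0 Ig x01) (compositions01 I0 Ig y01).
have /andP[_ h2] := compositions_lip Ig x01 y01.
by apply: le_trans h1 _; rewrite -mulrA ler_pM2l// (lip_gt0 If).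
Qed.

(** The other half of the multiplicativity up to a constant: the lower distortion
    bound for [f] turns a Lipschitz bound for [f \o g] into one for [g]. *)
Lemma lip_comp_ge m n f g :
  compositions (cf_ifs I) m f -> compositions (cf_ifs I) n g ->
  lip f * lip g <= 4 * lip (f \o g).
Proof.
move=> If Ig; have f0 := lip_gt0 If.
have Ifg := compositions_cat If Ig.
suff : lip g <= 4 * lip (f \o g) / lip f by rewrite ler_pdivlMr// mulrC.
apply: lip_le => [|x y x01 y01].
  by rewrite divr_ge0// ?mulr_ge0// ltW// (lip_gt0 Ifg).
have /andP[h1 _] := compositions_lip If (compositions01 I0 Ig x01) (compositions01 I0 Ig y01).
have /andP[_ h2] := compositions_lip Ifg x01 y01.
have h := le_trans h1 h2.
by rewrite [leRHS]mulrAC ler_pdivlMr//; lra.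
Qed.

Lemma lip_le_exp n f : compositions (cf_ifs I) n f -> lip f <= 4^-1 ^+ n.
Proof.
elim: n f => [f ->|n IH _ [f If [g Ig <-]]].
  by rewrite expr0; apply: lip_le => // x y _ _ /=; rewrite mul1r.
have If1 := compositions1 If.
apply: le_trans (lip_comp_le If1 Ig) _.
rewrite exprS ler_pM//; [exact/ltW/(lip_gt0 If1)|exact/ltW/(lip_gt0 Ig)| |exact: IH].
by apply: lip_le => [|x y x01 y01]; [rewrite invr_ge0|exact: (cf_ifs_contract I0 If)].
Qed.

End Lip.
End Compositions.

(** * Subadditive sequences *)

Section Fekete.
Context {R : realType}.

(** Fekete's lemma.  Dividing [n] by [m] gives [v n <= n * (v m / m) + K] with [K]
    depending only on [m], so the quotients converge to their infimum; the linear
    lower bound keeps it finite. *)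
Lemma fekete (v : nat -> R) (c : R) n0 : (forall m n, v (m + n)%N <= v m + v n) ->
    (forall n, - (c * n%:R) <= v n) -> (0 < n0)%N -> v n0 < 0 ->
  exists2 l : R, l < 0 & (n%:R^-1 * v n) @[n --> \oo] --> l.
Proof.
move=> vD vc n00 vn0.
pose X := [set v n / n%:R | n in [set n | (0 < n)%N]].
have lbX : has_lbound X.
  exists (- c) => _ [n /= n_0 <-]; rewrite ler_pdivlMr ?ltr0n//.
  by rewrite mulNr.
have infX n : (0 < n)%N -> inf X <= v n / n%:R.
  by move=> n_0; apply: ge_inf => //; exists n.
exists (inf X).
  by apply: le_lt_trans (infX _ n00) _; rewrite pmulr_llt0 ?invr_gt0 ?ltr0n.
apply/cvgrPdist_le => e e0.
have e20 : 0 < e / 2 by rewrite divr_gt0.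
have infX2 : has_inf X by split => //; exists (v n0 / n0%:R), n0.
have [_ [m /= m0 <-] vm] := inf_adherent e20 infX2.
set w := v m / m%:R in vm.
pose M := \sum_(r < m) `|v r|.
have mv q r : v (q * m + r)%N <= q%:R * v m + v r.
  elim: q => [|q IH]; first by rewrite mul0n mul0r add0r.
  rewrite mulSn -addnA; apply: le_trans (vD _ _) _.
  by rewrite -natr1; lra.
have vM n : v n <= n%:R * w + (m%:R * `|w| + M).
  rewrite {1}(divn_eq n m); apply: le_trans (mv _ _) _.
  have rm : (n %% m < m)%N by rewrite ltn_mod.
  have hM : v (n %% m)%N <= M.
    rewrite /M (bigD1 (Ordinal rm))//=; apply: le_trans (ler_norm _) _.
    by rewrite lerDl sumr_ge0.
  have -> : (n %/ m)%:R * v m = n%:R * w - (n %% m)%:R * w.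
    have nE : n%:R = (n %/ m)%:R * m%:R + (n %% m)%:R :> R.
      by rewrite -natrM -natrD -divn_eq.
    have wE : m%:R * w = v m by rewrite /w mulrCA divff ?mulr1// pnatr_eq0 -lt0n.
    by rewrite nE -wE; ring.
  have : - ((n %% m)%:R * w) <= m%:R * `|w|.
    rewrite -mulrN; apply: (@le_trans _ _ ((n %% m)%:R * `|w|)).
      by rewrite ler_wpM2l// -normrN ler_norm.
    by rewrite ler_wpM2r// ler_nat ltnW.
  lra.
set K := m%:R * `|w| + M in vM.
near=> n.
have n_0 : (0 < n)%N by near: n; exact: nbhs_infty_gt.
have n_0' : (0 : R) < n%:R by rewrite ltr0n.
have Kn : K / n%:R <= e / 2.
  rewrite ler_pdivrMr// mulrC -ler_pdivrMr//.
  by near: n; exact: nbhs_infty_ger.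
have h1 := infX _ n_0.
have h2 : v n / n%:R <= w + K / n%:R.
  by rewrite ler_pdivrMr// mulrDl divfK ?gt_eqF// mulrC.
rewrite (mulrC _ (v n)) ler_norml; apply/andP; split; lra.
Unshelve. all: by end_near.
Qed.

End Fekete.

(** * The pressure function *)

Section Pressure.
Context {R : realType}.
Variables (I : set nat) (I0 : I `<=` posnat) (Ine : I !=set0).
Implicit Types (f g : R -> R) (t s : R).

Notation M := (compositions (@cf_ifs R I)).

Lemma phiE n t : phi I n t = \esum_(f in M n) (lip f `^ t)%:E.
Proof.
apply: eq_esum => f /(lip_compositionsE I0) ->.
by rewrite poweR_EFin.
Qed.

Lemma cf_ifs_neq0 : exists f, @cf_ifs R I f.
Proof.
have [b Ib] := Ine; case: (pselect (I 1%N)) => I1.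
  by exists (fun x => (1 + (1%:R + x)^-1)^-1); right; split => //; right; exists 1%N.
by exists (cf_map b); left; split => //; exists b.
Qed.

Lemma compositions_lip_ge_expr : exists2 k : R, 0 < k &
  forall n, exists2 f, M n f & k ^+ n <= lip f.
Proof.
have [g Ig] := cf_ifs_neq0.
have Ig1 := compositions1 Ig.
have g0 := lip_gt0 I0 Ig1.
have := lip_le_exp I0 Ig1; rewrite expr1 => g1.
exists (lip g / 4); first by lra.
elim=> [|n [f If fn]].
  exists idfun => //; rewrite expr0.
  have h0 : 0 <= (0 : R) <= 1 by rewrite lexx ler01.
  have h1 : 0 <= (1 : R) <= 1 by rewrite lexx ler01.
  have /andP[_] := @compositions_lip R I I0 0 idfun 1 0 erefl h1 h0.
  by rewrite subr0 normr1 mulr1.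
exists (g \o f); first by exists g => //; exists f.
have := lip_comp_ge I0 Ig1 If; rewrite exprS.
have : lip g / 4 * (lip g / 4) ^+ n <= lip g / 4 * lip f by rewrite ler_wpM2l//; lra.
lra.
Qed.

Lemma phi_gt0 n t : (0 < phi I n t :> \bar R)%E.
Proof.
have [k _ /(_ n)[f If _]] := compositions_lip_ge_expr.
rewrite phiE; apply: lt_le_trans (esum_seq (s := [:: f]) _ _ _) => //.
  by rewrite big_cons big_nil adde0 lte_fin powR_gt0// (lip_gt0 I0 If).
by move=> g; rewrite inE => /eqP ->.
Qed.

Lemma phi_submul m n t a b : 0 <= t -> 0 <= a -> 0 <= b ->
  (phi I m t <= a%:E)%E -> (phi I n t <= b%:E)%E ->
  (phi I (m + n) t <= (a * b)%:E :> \bar R)%E.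
Proof.
move=> t0 a0 b0; rewrite !phiE => ha hb.
pose D := M m `*` M n; pose h (p : (R -> R) * (R -> R)) := p.1 \o p.2.
have MD : M (m + n) `<=` h @` D.
  elim: m {ha} @D => [|m IH] D f /=; first by move=> If; exists (idfun, f).
  move=> [f1 If1 [f2 /IH[[g1 g2] [/= Ig1 Ig2] <-] <-]].
  by exists (f1 \o g1, g2) => //; split => //; exists f1 => //; exists g1.
apply: le_trans (sub_esum _ MD) _.
apply: le_trans (esum_image_le _ _ _) _.
apply: (@le_trans _ _ (\esum_(p in D) (lip p.1 `^ t * lip p.2 `^ t)%:E)%E).
  apply: le_esum => -[f g] [/= If Ig]; rewrite lee_fin.
  have f0 := lip_gt0 I0 If; have g0 := lip_gt0 I0 Ig.
  have fg0 := lip_gt0 I0 (compositions_cat If Ig).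
  rewrite /h /= -powRM; [|exact: ltW|exact: ltW].
  by apply: powR_le; [|exact: ltW fg0|exact: lip_comp_le If Ig].
rewrite (_ : D = M m `*`` (fun=> M n)); last first.
  by apply/seteqP; split => -[f g].
rewrite -(@esum_esum R _ _ (M m) (fun=> M n) (fun f g => (lip f `^ t * lip g `^ t)%:E)); last first.
  by move=> f g; rewrite lee_fin mulr_ge0// powR_ge0.
apply: (@le_trans _ _ (\esum_(f in M m) (b * lip f `^ t)%:E)%E).
  apply: le_esum => f If; rewrite mulrC; apply: esum_scale_le => //.
  exact: powR_ge0.
by rewrite mulrC; exact: esum_scale_le.
Qed.

(** Composing with a fixed [g] on the right is injective and multiplies Lipschitz
    constants by at least [lip g / 4].  Hence finiteness at one level gives
    finiteness at all earlier levels. *)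
Lemma phi_bounded_by_later m t : 0 <= t -> exists2 C : R, 0 < C &
  forall n b, (phi I (n + m) t <= b%:E)%E -> (phi I n t <= (C * b)%:E :> \bar R)%E.
Proof.
move=> t0; have [k _ /(_ m)[g Ig _]] := compositions_lip_ge_expr.
have g0 := lip_gt0 I0 Ig.
exists ((4 / lip g) `^ t); first by rewrite powR_gt0// divr_gt0.
move=> n b; rewrite !phiE => hb.
apply: (@le_trans _ _ (\esum_(f in M n) ((4 / lip g) `^ t * lip (f \o g) `^ t)%:E)%E).
  apply: le_esum => f If; rewrite lee_fin.
  have f0 := lip_gt0 I0 If; have fg0 := lip_gt0 I0 (compositions_cat If Ig).
  have h : 0 <= 4 / lip g * lip (f \o g) by rewrite mulr_ge0 ?divr_ge0// ltW.
  rewrite -powRM; [|by rewrite divr_ge0// ltW|exact: ltW].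
  apply: powR_le; [by []|exact: ltW|].
  rewrite mulrAC ler_pdivlMr//; exact: (lip_comp_ge I0 If Ig).
apply: esum_scale_le; first exact: powR_ge0.
apply: le_trans hb.
rewrite -(@esum_image _ _ _ (M n) (fun f => f \o g) (fun f => (lip f `^ t)%:E)).
  by apply: sub_esum => _ [f If <-]; exact: compositions_cat.
move=> f f' _ _ ff'; apply/funext => y.
have [x <-] := compositions_surj y I0 Ig.
exact: (congr1 (@^~ x) ff').
Qed.

(** The limit of a divergent sequence is 0 by convention, so a negative pressure
    is a genuine limit and [phi I n t < 1] for all large [n]. *)
Lemma pressure_lt0_bounded t : 0 < t -> (pressure I t < 0 :> \bar R)%E ->
  exists2 C : R, 0 < C & forall n, (phi I n t <= C%:E :> \bar R)%E.
Proof.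
move=> t0; rewrite /pressure.
case: (pselect (cvgn (fun n => (n%:R^-1%:E * lne (phi I n t : \bar R))%E)));
  last by move=> /dvgP ->; rewrite ltxx.
set u := fun n => _ => cu lu.
have [N _ uN] : \forall n \near \oo, (u n < 0)%E.
  by apply: (cu [set y | y < 0]%E); apply: open_nbhs_nbhs; split => //; exact: open_ereal_lt_ereal.
have [C C0 hC] := phi_bounded_by_later N.+1 (ltW t0).
exists C => // n; rewrite -(mulr1 C); apply: hC; apply: ltW; rewrite -lne_lt0.
have /= := uN (n + N.+1)%N; rewrite /u pmule_rlt0 ?lte_fin ?invr_gt0 ?ltr0n ?addnS//.
by apply; rewrite ltnW// ltnS leq_addl.
Qed.

Lemma pressure_lt0 n t : 0 < t -> (0 < n)%N -> (phi I n t < 1 :> \bar R)%E ->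
  (pressure I t < 0 :> \bar R)%E.
Proof.
move=> t0 n0 pn.
have pM j : (phi I (j * n) t <= 1 :> \bar R)%E.
  elim: j => [|j IH].
    rewrite mul0n phiE; apply: esum_le_seq => s us sid.
    case: s us sid => [|f [|g s]] us sid.
    - by rewrite big_nil lee01.
    - rewrite big_cons big_nil adde0 lee_fin.
      have := lip_le_exp I0 (sid f (mem_head _ _)); rewrite expr0 => f1.
      rewrite -(powR1l t); apply: powR_le => //; first exact: ltW.
      exact/ltW/(lip_gt0 I0 (sid f (mem_head _ _))).
    - have /= fE := sid f (mem_head _ _).
      have /= gE : M 0 g by apply: sid; rewrite !inE eqxx orbT.
      by move: us; rewrite fE gE /= mem_head.
  by rewrite mulSn -(mulr1 1); apply: phi_submul => //; exact: ltW.
have pfin k : phi I k t = (fine (phi I k t : \bar R))%:E.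
  have [C C0 hC] := phi_bounded_by_later (k * n - k)%N (ltW t0).
  have /hC h : (phi I (k + (k * n - k)) t <= 1%:E :> \bar R)%E.
    by rewrite subnKC ?pM// leq_pmulr.
  by rewrite fineK// ge0_fin_numE ?(ltW (phi_gt0 _ _))// (le_lt_trans h)// ltry.
set a := fun k => fine (phi I k t : \bar R).
have a0 k : 0 < a k by rewrite -lte_fin -pfin phi_gt0.
have [k k0 kP] := compositions_lip_ge_expr.
have aD m m' : ln (a (m + m')%N) <= ln (a m) + ln (a m').
  rewrite -lnM ?posrE// ler_ln ?posrE ?mulr_gt0//.
  by rewrite -lee_fin -pfin; apply: phi_submul;
    [exact: ltW|exact: ltW|exact: ltW|by rewrite -pfin|by rewrite -pfin].
have aC m : - (- (t * ln k) * m%:R) <= ln (a m).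
  have [f If fk] := kP m.
  rewrite mulNr opprK mulrAC -mulrA.
  have -> : t * (m%:R * ln k) = ln ((k ^+ m) `^ t) by rewrite ln_powR lnXn// mulr_natl.
  rewrite ler_ln ?posrE ?powR_gt0 ?exprn_gt0//.
  apply: (@le_trans _ _ (lip f `^ t)).
    by apply: powR_le => //; [exact: ltW|rewrite exprn_ge0// ltW].
  rewrite -lee_fin -pfin phiE.
  apply: le_trans (esum_seq (s := [:: f]) _ _ _) => //.
    by rewrite big_cons big_nil adde0.
  by move=> g; rewrite inE => /eqP ->.
have an : ln (a n) < 0 by rewrite ln_lt0// a0/= -lte_fin -pfin.
have [l l0 hl] := fekete aD aC n0 an.
rewrite /pressure (_ : (fun n => _) = EFin \o (fun n => n%:R^-1 * ln (a n))); last first.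
  by apply/funext => m /=; rewrite pfin lne_EFin; [exact: EFinM|exact: a0].
rewrite (cvg_lim (@ereal_hausdorff R) (l := l%:E)) ?lte_fin//.
by apply: cvg_EFin => /=; [exact: nearW|exact: hl].
Qed.

(** Raising the exponent from [t] to [s] gains the factor [4^-1 ^+ n `^ (s - t)] on
    each [n]-fold composition. *)
Lemma phi_summable t s : 0 < t < s -> (pressure I t < 0 :> \bar R)%E ->
  exists w : nat -> R, exists2 b : R, 0 <= b &
    [/\ forall k, 0 <= w k, forall k, (phi I k s <= (w k)%:E :> \bar R)%E
      & forall n, \sum_(k < n) w k <= b].
Proof.
move=> /andP[t0 ts] /(pressure_lt0_bounded t0)[C C0 hC].
pose r : R := 4^-1 `^ (s - t).
have st0 : 0 < s - t by rewrite subr_gt0.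
have r0 : 0 < r by rewrite powR_gt0.
have r1 : r < 1.
  rewrite /r -[ltRHS](powR1l (s - t)); apply: gt0_ltr_powR => //; rewrite ?nnegrE ?invr_ge0//.
  by rewrite invf_lt1 ?ltr1n.
exists (fun k => r ^+ k * C), (C / (1 - r)).
  by rewrite divr_ge0// ?subr_ge0 ltW.
split=> [k|k|n].
- by rewrite mulr_ge0// ?exprn_ge0// ltW.
- rewrite phiE.
  apply: (@le_trans _ _ (\esum_(f in M k) (r ^+ k * lip f `^ t)%:E)%E).
    apply: le_esum => f If; rewrite lee_fin.
    have f0 := lip_gt0 I0 If.
    rewrite -[in leLHS](subrK t s) powRD ?(gt_eqF f0) ?implybT//.
    rewrite ler_wpM2r ?powR_ge0// /r -powR_mulrn ?powR_ge0// powRAC powR_mulrn ?invr_ge0//.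
    by apply: powR_le; [exact: ltW|exact: ltW|exact: lip_le_exp If].
  by apply: esum_scale_le; [rewrite exprn_ge0// ltW|rewrite -phiE].
- rewrite -mulr_suml mulrC ler_pM2l//; apply: geometric_sum_le.
  by rewrite r1 ltW.
Qed.

(** Lowering the exponent makes the sums grow exponentially, beyond any constant
    that later arguments lose. *)
Lemma phi_large t s : 0 < s < t -> (forall n, (0 < n)%N -> (1 <= phi I n t :> \bar R)%E) ->
  forall C : R, exists2 n, (0 < n)%N & exists2 G : seq (R -> R),
    uniq G /\ (forall f, f \in G -> M n f) & C <= \sum_(f <- G) lip f `^ s.
Proof.
move=> /andP[s0 st] hphi C.
pose r : R := 4^-1 `^ (t - s).
have st0 : 0 < t - s by rewrite subr_gt0.
have r0 : 0 < r by rewrite powR_gt0.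
have r1 : r < 1.
  rewrite /r -[ltRHS](powR1l (t - s)); apply: gt0_ltr_powR => //; rewrite ?nnegrE ?invr_ge0//.
  by rewrite invf_lt1 ?ltr1n.
have C0 : 0 < `|C| + 1 by rewrite ltr_wpDl.
have [||n n0 nC] := @expr_small R r (`|C| + 1)^-1.
- by rewrite r1 ltW.
- by rewrite invr_gt0.
exists n => //; apply: contrapT => noG.
have hs : (phi I n s <= (`|C| + 1)%:E :> \bar R)%E.
  rewrite phiE; apply: esum_le_seq => G uG GM; rewrite sumEFin lee_fin.
  rewrite leNgt; apply/negP => CG; apply: noG; exists G; first by split.
  apply: le_trans (ltW CG); apply: le_trans (ler_norm C) _; by rewrite lerDl.
have := hphi n n0; rewrite leNgt => /negP; apply.
apply: (@le_lt_trans _ _ (r ^+ n * (`|C| + 1))%:E); last first.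
  by rewrite lte_fin -ltr_pdivlMr// mul1r.
rewrite phiE.
apply: (@le_trans _ _ (\esum_(f in M n) (r ^+ n * lip f `^ s)%:E)%E).
  apply: le_esum => f If; rewrite lee_fin.
  have f0 := lip_gt0 I0 If.
  rewrite -[in leLHS](subrK s t) powRD ?(gt_eqF f0) ?implybT//.
  rewrite ler_wpM2r ?powR_ge0// /r -powR_mulrn ?powR_ge0// powRAC powR_mulrn ?invr_ge0//.
  by apply: powR_le; [exact: ltW|exact: ltW|exact: lip_le_exp If].
by apply: esum_scale_le; [rewrite exprn_ge0// ltW|rewrite -phiE].
Qed.

End Pressure.

(** * Upper bound for the upper intermediate dimension *)

Section UpperBound.
Context {R : realType}.
Variables (I : set nat) (I0 : I `<=` posnat) (Ine : I !=set0).
Implicit Types (f g : R -> R) (t s c delta theta lo : R).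

Notation M := (compositions (@cf_ifs R I)).
Notation F := (cf_set R I).

Lemma cf_set_ifs_unfold x : F x ->
  exists2 f, cf_ifs I f & exists2 y, F y & x = f y.
Proof.
move=> /(cf_set_unfold I0)[b Ib [y Fy ->]].
case: (pselect (I 1%N)) => I1; last first.
  by exists (cf_map b); [left; split => //; exists b|exists y].
case: (eqVneq b 1%N) => [->|b1]; last first.
  exists (cf_map b); last by exists y.
  by right; split => //; left; exists b => //; split => //; exact/eqP.
have [c Ic [z Fz ->]] := cf_set_unfold I0 Fy.
exists (fun x => (1 + (c%:R + x)^-1)^-1); last by exists z.
by right; split => //; right; exists c.
Qed.

Lemma cf_ifs_family f : cf_ifs I f ->
  exists2 b, I b & f = cf_map b \/ f = cf_map 1 \o cf_map b.
Proof.
move=> /(cf_ifs_cases I0)[[b Ib [_ ->]]|[_ [b Ib [_ ->]]]]; exists b => //.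
  by left.
by right.
Qed.

Let zero01 : 0 <= (0 : R) <= 1. Proof. by rewrite lexx ler01. Qed.

(** Covers of the reciprocals at the coarser scale [delta / lip f] are carried over
    by [f].  Two errors of size [delta `^ theta^-1] come from replacing [f (G b z)]
    by [f (G b 0)]; this is tolerated because
    [delta `^ theta^-1 <= lip f * (delta / lip f) `^ theta^-1]. *)
Lemma cover_small_images k f (G : nat -> R -> R) theta delta s c :
    0 < theta <= 1 -> 0 < delta -> M k f -> delta < lip f ->
    (forall d, 0 < d < 1 ->
      interval_cover (d `^ theta^-1) d s c (reciprocals R I)) ->
    (forall b b', (0 < b)%N -> (0 < b')%N ->
      `|G b 0 - G b' 0| <= `|b%:R^-1 - b'%:R^-1|) ->
  interval_cover (delta `^ theta^-1) delta s (9 * (lip f `^ s * c))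
    [set y | exists b z, [/\ I b, F z, cf_ifs I (G b),
       lip (f \o G b) < delta `^ theta^-1 & y = f (G b z)]].
Proof.
move=> /andP[t0 t1] d0 Mf df cE GL.
have f0 := lip_gt0 I0 Mf.
set lo := delta `^ theta^-1.
pose d' := delta / lip f.
have d'0 : 0 < d' by rewrite divr_gt0.
have d'1 : d' < 1 by rewrite ltr_pdivrMr// mul1r.
pose lo' := d' `^ theta^-1.
have lo'0 : 0 < lo' by rewrite powR_gt0.
have fd' : lip f * d' = delta by rewrite mulrC divfK// gt_eqF.
have f1 : lip f <= 1.
  apply: le_trans (lip_le_exp I0 Mf) _.
  by rewrite exprn_ile1// ?invr_ge0// invf_le1// ler1n.
have lolo : lo <= lip f * lo'.
  rewrite /lo -fd' powRM; [|exact: ltW|exact: ltW].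
  by rewrite ler_wpM2r ?powR_ge0// ge1r_powR ?f0// invf_ge1.
apply: (interval_cover_lo lolo); rewrite -[X in interval_cover _ X]fd'.
pose rel (x y : R) := exists b z, [/\ I b, x = b%:R^-1 & [/\ F z, cf_ifs I (G b),
       lip (f \o G b) < lo & y = f (G b z)]].
apply: (@interval_cover_transfer _ _ _ _ _ _ 2 (reciprocals R I) _ rel) => //.
- move=> y [b [z [Ib Fz Gb fG yE]]]; exists b%:R^-1; first by exists b.
  by exists b, z.
- move=> x x' y y' [b [z [Ib -> [Fz Gb fG ->]]]] [b' [z' [Ib' -> [Fz' Gb' fG' ->]]]].
  have near (b1 : nat) (z1 : R) : F z1 -> cf_ifs I (G b1) -> lip (f \o G b1) < lo ->
      `|f (G b1 z1) - f (G b1 0)| <= lip f * lo'.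
    move=> /cf_set01 z01 Gb1 fG1; have MfG := compositions_cat Mf (compositions1 Gb1).
    have /andP[_] := compositions_lip I0 MfG z01 zero01.
    rewrite subr0 /= => /le_trans; apply; apply: le_trans lolo; apply: le_trans (ltW fG1).
    have := lip_gt0 I0 MfG; case/andP: z01 => z0 z1' l0.
    by rewrite ger0_norm// ler_piMr// ltW.
  have h1 := near _ _ Fz Gb fG.
  have h2 := near _ _ Fz' Gb' fG'.
  have /andP[_ h3] := compositions_lip I0 Mf (cf_ifs01 I0 Gb zero01) (cf_ifs01 I0 Gb' zero01).
  have h4 := GL b b' (I0 Ib) (I0 Ib').
  have h5 : lip f * `|G b 0 - G b' 0| <= lip f * `|b%:R^-1 - b'%:R^-1| by rewrite ler_pM2l.
  set m := Num.max _ _.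
  have h6 : lip f * lo' <= lip f * m by rewrite ler_pM2l// /m le_max lexx orbT.
  have h7 : lip f * `|b%:R^-1 - b'%:R^-1| <= lip f * m by rewrite ler_pM2l// /m le_max lexx.
  have -> : f (G b z) - f (G b' z') = (f (G b z) - f (G b 0)) +
     (f (G b 0) - f (G b' 0)) - (f (G b' z') - f (G b' 0)) by ring.
  apply: le_trans (ler_normB _ _) _.
  apply: le_trans (lerD (ler_normD _ _) (lexx _)) _.
  lra.
- by apply: cE; rewrite d'0.
Qed.

(** The part of the limit set in pieces that are still too large at stage [k]. *)
Definition remainder delta k : set R :=
  \bigcup_(f in [set f | M k f /\ delta < lip f]) (f @` F).

(** A point leaves the remainder at stage [k] either in a piece whose Lipschitz
    constant lies between the two admissible lengths, counted in [w k.+1], or in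
    a tiny piece, counted in [w k] through its parent. *)
Lemma cover_minus_remainder theta delta s c (w : nat -> R) k :
    0 < theta <= 1 -> 0 < delta < 1 -> 0 <= s -> 0 <= c ->
    (forall d, 0 < d < 1 ->
      interval_cover (d `^ theta^-1) d s c (reciprocals R I)) ->
    (forall j, 0 <= w j) -> (forall j, (phi I j s <= (w j)%:E :> \bar R)%E) ->
  interval_cover (delta `^ theta^-1) delta s
    (18 * c * (\sum_(j < k) w j) + 3 * \sum_(j < k.+1) w j)
    (F `\` remainder delta k).
Proof.
move=> t01 /andP[d0 d1] s0 c0 cE w0 phiw; set lo := delta `^ theta^-1.
have lo0 : 0 < lo by rewrite powR_gt0.
elim: k => [|k IH].
  apply: (@interval_cover_weaken _ _ _ _ 0 _ _ (F `\` remainder delta 0)) => //.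
    by rewrite big_ord0 mulr0 add0r mulr_ge0// sumr_ge0.
  apply: interval_cover0 => x [Fx]; apply.
  exists idfun; last by exists x.
  split => //; rewrite (lt_le_trans d1)//.
  have h1 : 0 <= (1 : R) <= 1 by rewrite lexx ler01.
  have /andP[_] := @compositions_lip R I I0 0 idfun 1 0 erefl h1 zero01.
  by rewrite subr0 normr1 mulr1.
pose B f := [set y | exists g z, [/\ F z, cf_ifs I g, lip (f \o g) < lo & y = f (g z)]].
have hB f : M k f -> delta < lip f -> interval_cover lo delta s (18 * c * lip f `^ s) (B f).
  move=> Mf df.
  have hG1 b b' : (0 < b)%N -> (0 < b')%N ->
      `|cf_map b 0 - cf_map b' 0| <= `|b%:R^-1 - b'%:R^-1| :> R.
    by rewrite /cf_map !addr0.
  have hG2 b b' : (0 < b)%N -> (0 < b')%N ->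
      `|(cf_map 1 \o cf_map b) 0 - (cf_map 1 \o cf_map b') 0| <= `|b%:R^-1 - b'%:R^-1| :> R.
    move=> b0 b'0; rewrite /cf_map /= !addr0.
    have bv : 0 < (b%:R : R)^-1 by rewrite invr_gt0 ltr0n.
    have b'v : 0 < (b'%:R : R)^-1 by rewrite invr_gt0 ltr0n.
    set u := b%:R^-1 in bv *; set v := b'%:R^-1 in b'v *.
    have -> : (1 + u)^-1 - (1 + v)^-1 = (v - u) / ((1 + u) * (1 + v)).
      by field; apply/andP; split; rewrite gt_eqF//; lra.
    have h : 1 <= (1 + u) * (1 + v) by nra.
    rewrite normrM [`|v - u|]distrC ler_piMr// ger0_norm ?invr_ge0; last lra.
    by rewrite invf_le1//; lra.
  (* one term for each of the two shapes of the members of the system *)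
  have h1 := cover_small_images (G := cf_map) t01 d0 Mf df cE hG1.
  have h2 := cover_small_images (G := fun b => cf_map 1 \o cf_map b) t01 d0 Mf df cE hG2.
  apply: interval_cover_weaken (interval_coverU h1 h2).
    move=> y [g [z [Fz Ig fg yE]]].
    have [b Ib gE] := cf_ifs_family Ig.
    by case: gE => gE; [left|right]; exists b, z; rewrite -gE; split.
  by rewrite le_eqVlt; apply/orP; left; apply/eqP; ring.
pose G1 := [set f | M k f /\ delta < lip f].
pose G2 := [set f | M k.+1 f /\ lo <= lip f <= delta].
have cG1 : interval_cover lo delta s (18 * c * w k) (\bigcup_(f in G1) B f).
  apply: (@interval_cover_bigcup _ _ G1 B (fun f => lip f `^ s) _ _ _ _ _ (delta `^ s)).
  - by rewrite powR_gt0.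
  - by move=> f [Mf df]; apply: powR_le => //; exact: ltW.
  - by rewrite mulr_ge0.
  - by move=> f [Mf df]; exact: hB.
  - apply: le_trans (phiw k); rewrite phiE//.
    by apply: sub_esum => f [].
have cG2 : interval_cover lo delta s (3 * w k.+1) (\bigcup_(f in G2) (f @` F)).
  apply: (@interval_cover_bigcup _ _ G2 (fun f => f @` F) (fun f => lip f `^ s) _ _ _ _ _ (lo `^ s)) => //.
  - by rewrite powR_gt0.
  - by move=> f [Mf /andP[lof _]]; apply: powR_le => //; exact: ltW.
  - move=> f [Mf lof]; have f0 := lip_gt0 I0 Mf.
    apply: (@interval_cover_small _ _ _ _ _ 0) => //.
    move=> _ _ [x /cf_set01 x01 <-] [y /cf_set01 y01 <-].
    have /andP[_] := compositions_lip I0 Mf x01 y01; move=> /le_trans; apply.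
    rewrite mul1r ler_piMr//; first exact: ltW.
    case/andP: x01 => x0 x1; case/andP: y01 => y0 y1.
    by rewrite ler_norml; apply/andP; split; lra.
  - apply: le_trans (phiw k.+1); rewrite phiE//.
    by apply: sub_esum => f [].
apply: interval_cover_weaken (interval_coverU (interval_coverU IH cG1) cG2).
  move=> x [Fx nx].
  case: (pselect (remainder delta k x)) => [[f [Mf df] [y Fy yx]]|nk]; last first.
    by left; left.
  have [g Ig [z Fz yz]] := cf_set_ifs_unfold Fy.
  have Mfg : M k.+1 (f \o g) by rewrite -addn1; apply: compositions_cat => //; exact: compositions1.
  have xfg : x = f (g z) by rewrite -yx yz.
  case: (ltP (lip (f \o g)) lo) => fglo.
    by left; right; exists f => //; exists g, z.
  case: (leP (lip (f \o g)) delta) => fgd.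
    by right; exists (f \o g); [split => //; rewrite fglo|exists z].
  by exfalso; apply: nx; exists (f \o g) => //; exists z.
have e1 : \sum_(j < k.+1) w j = \sum_(j < k) w j + w k by rewrite big_ord_recr.
have e2 : \sum_(j < k.+2) w j = \sum_(j < k.+1) w j + w k.+1 by rewrite big_ord_recr.
rewrite e2 e1.
by rewrite le_eqVlt; apply/orP; left; apply/eqP; ring.
Qed.

Lemma cf_set_cover theta s t c : 0 < theta <= 1 -> 0 < t < s -> 0 <= c ->
    (pressure I t < 0 :> \bar R)%E ->
    (forall d, 0 < d < 1 ->
      interval_cover (d `^ theta^-1) d s c (reciprocals R I)) ->
  exists2 C, 0 <= C & forall d, 0 < d < 1 ->
      interval_cover (d `^ theta^-1) d s C F.
Proof.
move=> t01 ts c0 /(phi_summable I0 Ine ts)[w [b b0 [w0 phiw wb]]] cE.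
have s0 : 0 <= s by case/andP: ts => /ltW h /ltW; exact: le_trans.
exists (18 * c * b + 3 * b); first by rewrite addr_ge0 ?mulr_ge0.
move=> d d01; have /andP[d0 d1] := d01.
have [||k _ kd] := @expr_small R 4^-1 d => //.
  by rewrite invr_ge0 ler0n invf_lt1 ?ltr1n.
apply: interval_cover_weaken (cover_minus_remainder k t01 d01 s0 c0 cE w0 phiw).
  move=> x Fx; split=> // -[f [Mf df] _].
  by have := lt_trans (le_lt_trans (lip_le_exp I0 Mf) kd) df; rewrite ltxx.
by rewrite lerD// ler_wpM2l// mulr_ge0.
Qed.

Lemma upper_dim_cf_set_le theta : 0 < theta <= 1 ->
  (upper_dim theta F <= maxe (bowen_h R I) (upper_dim theta (reciprocals R I)))%E.
Proof.
move=> t01; have /andP[t0 t1] := t01.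
have H s : (maxe (bowen_h R I) (upper_dim theta (reciprocals R I)) < s%:E)%E ->
    (upper_dim theta F <= s%:E)%E.
  rewrite gt_max => /andP[/ereal_inf_ltP[_ [t [t_0 Pt] <-]]]; rewrite lte_fin => ts.
  have E01 : reciprocals R I `<=` `[0, 1].
    move=> _ [b /I0 b0 <-]; rewrite /= in_itv/= invr_ge0 ler0n invf_le1 ?ltr0n//.
    by rewrite ler1n.
  move=> /(upper_dim_lt t01 E01)[c c0 cE].
  have ts' : 0 < t < s by rewrite t_0.
  have [C C0 hC] := cf_set_cover t01 ts' c0 Pt cE.
  by apply: (upper_dim_le t0 _ C0 hC); rewrite ltW// (lt_trans t_0).
move: H; set m := maxe _ _ => H.
case: m H => [r| |] H.
- by apply/lee_addgt0Pr => e e0; rewrite -EFinD; apply: H; rewrite lte_fin ltrDl.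
- by rewrite leey.
- have := H (-1) (ltNyr _); rewrite leNgt => /negP; case.
  apply: (@lt_le_trans _ _ 0%E); first by rewrite lte_fin ltrN10.
  apply: le_trans (hausdorff_dim_ge0 F) _.
  exact: le_trans (hausdorff_le_lower_dim theta F) (lower_le_upper_dim theta F).
Qed.

End UpperBound.

(** * Limit points of infinite compositions *)

Section LimitPoints.
Context {R : realType}.
Implicit Types (x y : R).

(** The point [x n] is the common point of the nested images of [[0, 1]] under
    [f n \o ... \o f (n + k)], obtained as the supremum of the lower
    bounds [p k n - 4^-1 ^+ k]. *)
Lemma contractions_limit (f : nat -> R -> R) :
    (forall n x, 0 <= x <= 1 -> 0 <= f n x <= 1) ->
    (forall n x y, 0 <= x <= 1 -> 0 <= y <= 1 -> `|f n x - f n y| <= 4^-1 * `|x - y|) ->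
  exists x : nat -> R, forall n, 0 <= x n <= 1 /\ x n = f n (x n.+1).
Proof.
move=> f01 fL.
pose p := fix p k n : R := if k is k'.+1 then f n (p k' n.+1) else 0.
have p01 k n : 0 <= p k n <= 1.
  elim: k n => [|k IH] n /=; first by rewrite lexx ler01.
  exact/f01/IH.
have p_near k j n : (k <= j)%N -> `|p k n - p j n| <= 4^-1 ^+ k.
  elim: k j n => [|k IH] j n.
    have /andP[h1 h2] := p01 j n; rewrite sub0r normrN ger0_norm//= expr0 => _; exact: h2.
  case: j => // j kj /=; apply: le_trans (fL n _ _ (p01 _ _) (p01 _ _)) _.
  by rewrite exprS ler_pM2l ?invr_gt0//; exact: IH.
have p_lr k j n : p k n - 4^-1 ^+ k <= p j n + 4^-1 ^+ j.
  have k0 : 0 <= 4^-1 ^+ k :> R by rewrite exprn_ge0// invr_ge0.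
  have j0 : 0 <= 4^-1 ^+ j :> R by rewrite exprn_ge0// invr_ge0.
  have [kj|jk] := leqP k j.
    by have := p_near _ _ n kj; rewrite ler_norml => /andP[_]; lra.
  by have := p_near _ _ n (ltnW jk); rewrite ler_norml => /andP[+ _]; lra.
pose X n := range (fun k => p k n - 4^-1 ^+ k).
have supX n : has_sup (X n).
  split; first by exists (p 0%N n - 4^-1 ^+ 0), 0%N.
  by exists (p 0%N n + 4^-1 ^+ 0) => _ [k _ <-]; exact: p_lr.
pose x n := sup (X n).
have px k n : `|p k n - x n| <= 4^-1 ^+ k.
  have h1 : p k n - 4^-1 ^+ k <= x n by apply: sup_upper_bound => //; exists k.
  have h2 : x n <= p k n + 4^-1 ^+ k.
    apply: ge_sup; first by case: (supX n).
    by move=> _ [j _ <-]; exact: p_lr.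
  by rewrite ler_norml; apply/andP; split; lra.
have x01 n : 0 <= x n <= 1.
  apply/andP; split.
    rewrite leNgt; apply/negP => x0; have nx0 : 0 < - x n by lra.
    have [||k _] := @expr_small R 4^-1 (- x n) => //.
      by rewrite invr_ge0 ler0n invf_lt1 ?ltr1n.
    by have := px k n; have := p01 k n; rewrite ler_norml => /andP[? ?] /andP[? ?] ?; lra.
  rewrite leNgt; apply/negP => x0; have nx0 : 0 < x n - 1 by lra.
  have [||k _] := @expr_small R 4^-1 (x n - 1) => //.
    by rewrite invr_ge0 ler0n invf_lt1 ?ltr1n.
  by have := px k n; have := p01 k n; rewrite ler_norml => /andP[? ?] /andP[? ?] ?; lra.
exists x => n; split => //; apply/eqP; rewrite -subr_eq0 -normr_eq0.
rewrite eq_le normr_ge0 andbT leNgt; apply/negP => xf0.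
have [||k _] := @expr_small R 4^-1 `|x n - f n (x n.+1)| => //.
  by rewrite invr_ge0 ler0n invf_lt1 ?ltr1n.
apply/negP; rewrite -leNgt.
have h1 := px k.+1 n; rewrite /= in h1.
have h2 := le_trans (fL n _ _ (p01 k n.+1) (x01 n.+1)) (ler_wpM2l _ (px k n.+1)).
have h3 : 0 <= 4^-1 ^+ k :> R by rewrite exprn_ge0// invr_ge0.
have -> : x n - f n (x n.+1) = (f n (p k n.+1) - f n (x n.+1)) - (f n (p k n.+1) - x n) by ring.
apply: le_trans (ler_normB _ _) _.
move: h1; rewrite exprS; have := h2 _; rewrite invr_ge0 ler0n => /(_ isT); lra.
Qed.

Variables (I : set nat) (I0 : I `<=` posnat).
Notation M := (compositions (@cf_ifs R I)).

Lemma cf_set_ifs_coind (B : set R) : (forall x, B x -> 0 <= x <= 1) ->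
    (forall x, B x -> exists2 f, cf_ifs I f & exists2 y, B y & x = f y) ->
  B `<=` cf_set R I.
Proof.
move=> B01 Bf.
pose A : set R := B `|` [set x | exists2 b, I b & exists2 y, B y & x = cf_map b y].
apply: (@subset_trans _ A); first by move=> x Bx; left.
apply: cf_set_coind => // x [].
- exact: B01.
- move=> [b Ib [y /B01 y01 ->]]; by have /andP[/ltW -> ->] := cf_map01 (I0 Ib) y01.
- move=> /Bf[f If [y By ->]].
  case: (cf_ifs_cases I0 If) => [[b Ib [_ ->]]|[I1 [b Ib [_ ->]]]].
    by exists b => //; exists y => //; left.
  by exists 1%N => //; exists (cf_map b y) => //; right; exists b => //; exists y.
- by move=> [b Ib [y By ->]]; exists b => //; exists y => //; left.
Qed.

(** The compositions have varying numbers of digits.  The coinduction runs over all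
    points [c (x n)] with [c] a composition, which avoids flattening words. *)
Lemma cf_set_limit_points (f : nat -> R -> R) : (forall n, exists m, M m.+1 (f n)) ->
  exists x : nat -> R, forall n, cf_set R I (x n) /\ x n = f n (x n.+1).
Proof.
move=> Mf.
have [n z z01|n z y z01 y01|x xP] := @contractions_limit f.
- by have [m Mfn] := Mf n; exact: (compositions01 I0 Mfn).
- have [m Mfn] := Mf n; have /andP[_ h] := compositions_lip I0 Mfn z01 y01.
  apply: le_trans h _; rewrite ler_wpM2r//; apply: le_trans (lip_le_exp I0 Mfn) _.
  rewrite exprS ler_piMr ?invr_ge0// exprn_ile1// ?invr_ge0// invf_le1// ler1n.
  by [].
exists x => n; split; last by have [] := xP n.
pose B : set R := [set z | exists n j c, M j c /\ z = c (x n)].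
apply: (@cf_set_ifs_coind B); last by exists n, 0%N, idfun.
- move=> _ [k [j [c [Mc ->]]]]; apply: (compositions01 I0 Mc).
  by have [] := xP k.
- move=> _ [k [[|j] [c [/= Mc ->]]]].
    rewrite Mc /=; have [_ ->] := xP k; have [m [g Ig [c' Mc' <-]]] := Mf k.
    by exists g => //; exists (c' (x k.+1)) => //; exists k.+1, m, c'.
  case: Mc => g Ig [c' Mc' <-].
  by exists g => //; exists (c' (x k)) => //; exists k, j, c'.
Qed.

Lemma cf_set_neq0 : I !=set0 -> cf_set R I !=set0.
Proof.
move=> Ine; have [f If] := @cf_ifs_neq0 R I Ine.
have [n|x xP] := @cf_set_limit_points (fun=> f); first by exists 0%N; exact: compositions1.
by exists (x 0%N); have [] := xP 0%N.
Qed.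

Lemma cf_set_cf_map b x : I b -> cf_set R I x -> cf_set R I (cf_map b x).
Proof.
move=> Ib Fx; pose A : set R := cf_set R I `|` [set cf_map b x].
apply: (@cf_set_coind R I A) => //; last by right.
  move=> y [/cf_set01 //|->]; have /cf_set01 x01 := Fx.
  by have /andP[/ltW -> ->] := cf_map01 (I0 Ib) x01.
move=> y [/(cf_set_unfold I0)[c Ic [z Fz ->]]|->].
  by exists c => //; exists z => //; left.
by exists b => //; exists x => //; left.
Qed.

Lemma cf_set_compositions n f x : M n f -> cf_set R I x -> cf_set R I (f x).
Proof.
elim: n f => [f -> //|n IH _ [f If [g /IH h <-]]] /h /= Fgx.
case: (cf_ifs_cases I0 If) => [[b Ib [_ ->]]|[I1 [b Ib [_ ->]]]].
  exact: cf_set_cf_map.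
by apply: cf_set_cf_map => //; exact: cf_set_cf_map.
Qed.

End LimitPoints.

(** * The set of reciprocals *)

Section Reciprocals.
Context {R : realType}.
Variables (I : set nat) (I0 : I `<=` posnat).

(** For a point [x] of the limit set, [1/(b + x)] belongs to it for all digits [b],
    and sending [1/(b + x)] to [1/b] is 4-Lipschitz. *)
Lemma dim_reciprocals_le (theta : R) : I !=set0 -> 0 < theta ->
  (lower_dim theta (reciprocals R I) <= lower_dim theta (cf_set R I))%E /\
  (upper_dim theta (reciprocals R I) <= upper_dim theta (cf_set R I))%E.
Proof.
move=> Ine t0; have [x Fx] := @cf_set_neq0 R I I0 Ine.
have /cf_set01/andP[x0 x1] := Fx.
apply: (@dim_transfer _ _ 12) => // lo hi s c lo0 h.
pose rel (u v : R) := exists2 b, I b & u = cf_map b x /\ v = b%:R^-1.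
have := @interval_cover_transfer R lo hi s c 1 3 (cf_set R I) (reciprocals R I) rel lo0 ltr01.
rewrite !mul1r powR1l mul1r; apply => //.
- move=> _ [b Ib <-]; exists (cf_map b x); last by exists b.
  exact: cf_set_cf_map.
- move=> _ _ _ _ [b Ib [-> ->]] [b' Ib' [-> ->]].
  have b1 : (1 : R) <= b%:R by rewrite ler1n; exact: I0.
  have b1' : (1 : R) <= b'%:R by rewrite ler1n; exact: I0.
  apply: (@le_trans _ _ (4 * `|cf_map b x - cf_map b' x|)); last first.
    by rewrite ler_pM2l// mul1r le_max lexx.
  rewrite /cf_map; set B : R := b%:R in b1 *; set B' : R := b'%:R in b1' *.
  have -> : B^-1 - B'^-1 = (B' - B) / (B * B').
    by field; apply/andP; split; rewrite gt_eqF//; lra.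
  have -> : (B + x)^-1 - (B' + x)^-1 = (B' - B) / ((B + x) * (B' + x)).
    by field; apply/andP; split; rewrite gt_eqF//; lra.
  have h1 : 0 < B * B' by nra.
  have h2 : 0 < (B + x) * (B' + x) by nra.
  have h3 : (B + x) * (B' + x) <= 4 * (B * B') by nra.
  rewrite !normrM mulrCA ler_wpM2l// !ger0_norm ?invr_ge0; [|lra|lra].
  by rewrite -ler_pdivrMl// -invfM lef_pV2 ?posrE//; lra.
Qed.

(** About [1/d] reciprocals exceed [d]; each takes one interval of length
    [d `^ theta^-1], of cost [d].  All the others lie in [[0, d]]. *)
Lemma upper_dim_reciprocals_le (theta : R) : 0 < theta <= 1 ->
  (upper_dim theta (reciprocals R I) <= theta%:E)%E.
Proof.
move=> /andP[t0 t1]; apply: (@upper_dim_le _ _ _ 3 _ t0 (ltW t0)) => // d /andP[d0 d1].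
set lo := d `^ theta^-1.
have lod : lo <= d by rewrite /lo ge1r_powR ?invf_ge1// d0 ltW.
have lot : lo `^ theta = d by rewrite /lo -powRrM mulVf ?gt_eqF// powRr1// ltW.
pose N := (Num.truncn d^-1).+1.
have dv0 : 0 <= d^-1 by rewrite invr_ge0 ltW.
have [N1 N2] : d^-1 < N%:R /\ N%:R <= d^-1 + 1.
  by rewrite /N truncnS_gt -natr1 lerD2r truncn_le.
have h1 : interval_cover lo d theta (\sum_(b <- iota 0 N) d)
    [set y | exists2 b, b \in iota 0 N & [set b%:R^-1] y].
  apply: interval_cover_seq => b _.
  exists [:: (b%:R^-1, lo)]; split.
  - by move=> p; rewrite inE => /eqP -> /=; rewrite lexx.
  - move=> _ ->; exists (b%:R^-1, lo); rewrite ?inE//= lexx lerDl.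
    exact: powR_ge0.
  - by rewrite big_cons big_nil addr0 lot.
have h2 : interval_cover lo d theta (d `^ theta) [set y | 0 <= y <= d].
  exists [:: (0, d)]; split.
  - by move=> p; rewrite inE => /eqP -> /=; rewrite lod lexx.
  - by move=> y yd; exists (0, d); rewrite ?inE//= add0r.
  - by rewrite big_cons big_nil addr0.
apply: interval_cover_weaken (interval_coverU h1 h2).
  move=> _ [b Ib <-]; have b0 : (0 : R) < b%:R by rewrite ltr0n; exact: I0.
  case: (ltnP b N) => bN; [left|right].
    by exists b => //; rewrite mem_iota.
  rewrite /= invr_ge0 ltW//= -[leRHS]invrK lef_pV2 ?posrE ?invr_gt0//.
  by apply: le_trans (ltW N1) _; rewrite ler_nat.
have h3 : d `^ theta <= 1 by rewrite -[leRHS](powR1l theta); apply: powR_le; lra.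
have -> : \sum_(b <- iota 0 N) d = N%:R * d.
  by rewrite big_const_seq count_predT size_iota iter_addr_0 mulr_natl.
have : N%:R * d <= (d^-1 + 1) * d by rewrite ler_pM2r.
by rewrite mulrDl mulVf ?gt_eqF// mul1r; lra.
Qed.

End Reciprocals.

(** * Separation of the pieces with bounded digits *)

Section Bounded.
Context {R : realType}.
Variables (I : set nat) (I0 : I `<=` posnat).
Implicit Types (f g : R -> R) (x y : R).

(** Bounding the digits keeps the limit set away from the end points 0 and 1, where
    images under different digits touch. *)
Definition below N : set nat := [set b | I b /\ (b <= N)%N].

Lemma below_posnat N : below N `<=` posnat.
Proof. by move=> b [/I0]. Qed.

(** Membership is asked for all large bounds: the shape of the system depends on
    whether 1 is a digit, so it is not monotone in the set of digits in general. *)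
Lemma cf_ifs_below f : cf_ifs I f ->
  exists N, forall N', (N <= N')%N -> cf_ifs (below N') f.
Proof.
move=> [[nI1 [b Ib ->]]|[I1 [[b [Ib b1] ->]|[b Ib ->]]]].
- exists b => N' bN; left; split; first by case.
  by exists b.
- exists b.+1 => N' bN; right; split; first by split => //; exact: leq_trans bN.
  by left; exists b => //; split => //; split => //; exact: ltnW.
- exists b.+1 => N' bN; right; split; first by split => //; exact: leq_trans bN.
  by right; exists b => //; split => //; exact: ltnW.
Qed.

Lemma compositions_below n f : compositions (cf_ifs I) n f ->
  exists N, forall N', (N <= N')%N -> compositions (cf_ifs (below N')) n f.
Proof.
elim: n f => [f Mf|n IH _ [f If [g /IH[N hN] <-]]]; first by exists 0%N.
have [N1 hN1] := cf_ifs_below If.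
exists (maxn N N1) => N'; rewrite geq_max => /andP[h1 h2].
by exists f; [exact: hN1|exists g => //; exact: hN].
Qed.

Lemma compositions_seq_below n (G : seq (R -> R)) :
    (forall f, f \in G -> compositions (cf_ifs I) n f) ->
  exists N, forall N', (N <= N')%N -> forall f, f \in G -> compositions (cf_ifs (below N')) n f.
Proof.
elim: G => [|f G IH] GM; first by exists 0%N.
have [|N hN] := IH; first by move=> g gG; apply: GM; rewrite inE gG orbT.
have [N1 hN1] := compositions_below (GM f (mem_head _ _)).
exists (maxn N N1) => N'; rewrite geq_max => /andP[h1 h2] g.
by rewrite inE => /predU1P[->|gG]; [exact: hN1|exact: hN].
Qed.

Section Gap.
Variable N : nat.
Notation J := (below N).
Notation K := (cf_set R J).
Let J0 : J `<=` posnat := @below_posnat N.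

Let N1 : R := N%:R + 1.
Let eta : R := (N%:R + 2)^-1.
Let kappa : R := (N1 ^+ 4)^-1.

Let N1_ge1 : 1 <= N1. Proof. by rewrite /N1 lerDr. Qed.
Let N1_gt0 : 0 < N1. Proof. exact: lt_le_trans N1_ge1. Qed.
Let eta0 : 0 < eta. Proof. by rewrite /eta invr_gt0 ltr_wpDl. Qed.
Let N1_4 : 1 <= N1 ^+ 4. Proof. exact: exprn_ege1. Qed.
Let kappa0 : 0 < kappa. Proof. by rewrite invr_gt0 (lt_le_trans ltr01). Qed.
Let kappa1 : kappa <= 1. Proof. by rewrite invf_le1// (lt_le_trans ltr01). Qed.

Let Jbound b : J b -> 1 <= (b%:R : R) <= N%:R.
Proof. by move=> [/I0 b0 bN]; rewrite ler_nat bN ler1n b0. Qed.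

Let K_upper x : K x -> 0 <= x <= 1 - eta.
Proof.
move=> Kx; have /cf_set01/andP[-> _] := Kx.
have [b /Jbound/andP[b1 bN] [y Ky ->]] := cf_set_unfold J0 Kx.
have [c /Jbound/andP[c1 cN] [z /cf_set01/andP[z0 z1] ->]] := cf_set_unfold J0 Ky.
rewrite /cf_map /=.
have hy : (N%:R + 1)^-1 <= (c%:R + z)^-1 by rewrite lef_pV2 ?posrE; lra.
have -> : 1 - eta = (1 + (N%:R + 1)^-1)^-1.
  by rewrite /eta; field; repeat (apply/andP; split); rewrite gt_eqF//; lra.
have vN : 0 < (N%:R + 1)^-1 :> R by rewrite invr_gt0; lra.
by rewrite lef_pV2 ?posrE; lra.
Qed.

Let K_diam x y : K x -> K y -> `|x - y| <= 1 - eta.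
Proof.
move=> /K_upper/andP[x0 x1] /K_upper/andP[y0 y1].
by rewrite ler_norml; apply/andP; split; lra.
Qed.

Let cf_map_gap u v x y : J u -> J v -> u <> v -> K x -> K y ->
  eta * (N1 ^+ 2)^-1 <= `|cf_map u x - cf_map v y|.
Proof.
move=> Ju Jv uv Kx Ky.
have /andP[u1 uN] := Jbound Ju; have /andP[v1 vN] := Jbound Jv.
have /K_upper/andP[x0 x1] := Kx; have /K_upper/andP[y0 y1] := Ky.
have xy := K_diam Ky Kx.
have huv : 1 <= `|v%:R - u%:R| :> R.
  have [vu|vu] := leqP v u.
    rewrite distrC -natrB// normr_nat ler1n subn_gt0 ltn_neqAle vu andbT.
    by apply/eqP => /esym.
  by rewrite -natrB ?(ltnW vu)// normr_nat ler1n subn_gt0.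
have -> : cf_map u x - cf_map v y = ((v%:R - u%:R) + (y - x)) / ((u%:R + x) * (v%:R + y)).
  by rewrite /cf_map; field; apply/andP; split; rewrite gt_eqF//; lra.
have hn : eta <= `|(v%:R - u%:R) + (y - x)|.
  have := ler_normB ((v%:R - u%:R) + (y - x)) (y - x); rewrite addrK; lra.
have e0 : 0 < eta := eta0.
have ux0 : 0 < u%:R + x by lra.
have vy0 : 0 < v%:R + y by lra.
have ux1 : u%:R + x <= N1 by rewrite /N1; lra.
have vy1 : v%:R + y <= N1 by rewrite /N1; lra.
have uv0 : 0 < (u%:R + x) * (v%:R + y) by rewrite mulr_gt0.
rewrite normrM normfV (gtr0_norm uv0).
apply: ler_pM => //; first exact: ltW.
  by rewrite invr_ge0 exprn_ge0// ltW.
rewrite lef_pV2 ?posrE ?exprn_gt0// ?mulr_gt0//.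
by rewrite expr2 ler_pM// ltW.
Qed.

Let cf_map_lower b x y : (b <= N)%N -> (0 < b)%N -> 0 <= x <= 1 -> 0 <= y <= 1 ->
  (N1 ^+ 2)^-1 * `|x - y| <= `|cf_map b x - cf_map b y|.
Proof.
move=> bN b0 /andP[x0 x1] /andP[y0 y1].
have b1 : (1 : R) <= b%:R by rewrite ler1n.
have bN' : (b%:R : R) <= N%:R by rewrite ler_nat.
have -> : cf_map b x - cf_map b y = (y - x) / ((b%:R + x) * (b%:R + y)).
  by rewrite /cf_map; field; apply/andP; split; rewrite gt_eqF//; lra.
have bx : 0 < b%:R + x by lra.
have by_ : 0 < b%:R + y by lra.
rewrite normrM [`|y - x|]distrC mulrC ler_wpM2l// normfV ger0_norm; last first.
  by rewrite mulr_ge0// ltW.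
rewrite lef_pV2 ?posrE ?exprn_gt0// ?mulr_gt0//.
by rewrite expr2; apply: ler_pM; rewrite /N1; lra.
Qed.

Let N1_inv2 : 0 < (N1 ^+ 2)^-1.
Proof. by rewrite invr_gt0 exprn_gt0. Qed.

Let kappaE : kappa = (N1 ^+ 2)^-1 * (N1 ^+ 2)^-1.
Proof. by rewrite -invfM -exprD. Qed.

Let N1_inv2_le1 : (N1 ^+ 2)^-1 <= 1.
Proof. by rewrite invf_le1 ?exprn_ege1// exprn_gt0. Qed.

Let cf_ifs_lower f x y : cf_ifs J f -> 0 <= x <= 1 -> 0 <= y <= 1 ->
  kappa * `|x - y| <= `|f x - f y|.
Proof.
move=> Jf x01 y01; rewrite kappaE.
case: (cf_ifs_cases J0 Jf) => [[b [_ bN] [b1 ->]]|[[_ N_1] [b [_ bN] [b0 ->]]]].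
  apply: le_trans (cf_map_lower bN (ltnW b1) x01 y01).
  by rewrite ler_wpM2r// ler_piMr// ltW.
have b01 (z : R) : 0 <= z <= 1 -> 0 <= cf_map b z <= 1.
  by move=> /(cf_map01 b0)/andP[/ltW -> ->].
have h := cf_map_lower N_1 (ltn0Sn 0) (b01 _ x01) (b01 _ y01).
apply: (le_trans _ h).
rewrite -mulrA ler_pM2l//; exact: cf_map_lower.
Qed.

Let cf_ifs_gap f g x y : cf_ifs J f -> cf_ifs J g -> f <> g -> K x -> K y ->
  eta * kappa <= `|f x - g y|.
Proof.
move=> Jf Jg fg Kx Ky.
have weak z : eta * (N1 ^+ 2)^-1 <= z -> eta * kappa <= z.
  by apply: le_trans; rewrite ler_pM2l// kappaE ler_piMr// ltW.
have KJ b z : J b -> K z -> K (cf_map b z) by move=> Jb; exact: cf_set_cf_map.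
case: (cf_ifs_cases J0 Jf) fg => [[b Jb [b1 ->]]|[J1 [b Jb [b0 ->]]]];
  case: (cf_ifs_cases J0 Jg) => [[c Jc [c1 ->]]|[J1' [c Jc [c0 ->]]]] fg.
- by apply/weak/cf_map_gap => // bc; apply: fg; rewrite bc.
- apply/weak/cf_map_gap => //; last exact: KJ.
  by move=> b_1; move: b1; rewrite b_1.
- apply/weak/cf_map_gap => //; last exact: KJ.
  by move=> c_1; move: c1; rewrite -c_1.
- have bc : b <> c by move=> bc; apply: fg; rewrite bc.
  (* both start with the digit 1: compare the second digits *)
  have h := cf_map_gap Jb Jc bc Kx Ky.
  have /cf_set01 bx := KJ _ _ Jb Kx; have /cf_set01 cy := KJ _ _ Jc Ky.
  have N_1 : (1 <= N)%N by case: J1.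
  apply: le_trans (cf_map_lower N_1 (ltn0Sn 0) bx cy).
  by rewrite kappaE mulrCA ler_pM2l.
Qed.

(** Digit strings of different compositions diverge at some digit, none being a
    prefix of another, because 1 is always followed by a second digit.  The common
    maps before it contract distances at most by the factor [kappa] each, and two
    different digits leave a gap since the tails differ by at most [1 - eta]. *)
Lemma compositions_gap n : exists2 d : R, 0 < d & forall f g x y,
  compositions (cf_ifs J) n f -> compositions (cf_ifs J) n g -> f <> g ->
  K x -> K y -> d <= `|f x - g y|.
Proof.
exists (eta * kappa ^+ n.+1); first by rewrite mulr_gt0// exprn_gt0.
elim: n => [|n IH] f g x y; first by move=> -> ->.
move=> [f1 Jf1 [f' Mf' <-]] [g1 Jg1 [g' Mg' <-]] fg Kx Ky.
have Kf' := cf_set_compositions J0 Mf' Kx; have Kg' := cf_set_compositions J0 Mg' Ky.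
case: (pselect (f1 = g1)) => fg1; last first.
  apply: le_trans (cf_ifs_gap Jf1 Jg1 fg1 Kf' Kg').
  by rewrite ler_pM2l// exprS ler_piMr ?(ltW kappa0)// exprn_ile1// ltW.
rewrite -fg1 in Jg1 fg *.
have fg' : f' <> g' by move=> fg'; apply: fg; rewrite fg'.
apply: le_trans (cf_ifs_lower Jf1 (cf_set01 Kf') (cf_set01 Kg')).
by rewrite exprS mulrCA ler_pM2l//; exact: IH.
Qed.

End Gap.

End Bounded.

(** * Lower bound for the Hausdorff dimension *)

Section MassDistribution.
Context {R : realType}.
Variables (I : set nat) (I0 : I `<=` posnat).
Implicit Types (f g : R -> R) (x y : R).

Notation M := (compositions (@cf_ifs R I)).
Notation K := (cf_set R I).

(** Starting from the identity, a composition [g] with lower contraction ratio [r]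
    is extended by members of [G] while keeping the sets that meet [g @` K] of
    total weight at most [r `^ s * S].  Sets meeting two children have weight at
    least [(r * d) `^ s > r `^ s * S], so the children share the weight
    disjointly, and one of them gets at most its due, the dues summing to more
    than the total.  The limit point lies in some [U i], whose weight would be at
    most [r `^ s * S] for arbitrarily small [r]. *)
Lemma no_cheap_cover n (G : seq (R -> R)) (s d S : R) (D : set nat)
    (U : nat -> set R) (u : nat -> R) :
    (0 < n)%N -> uniq G -> (forall f, f \in G -> M n f) -> 0 < s ->
    1 < \sum_(f <- G) (lip f / 4) `^ s ->
    (forall f g x y, f \in G -> g \in G -> f <> g -> K x -> K y -> d <= `|f x - g y|) ->
    0 < d -> 0 < S -> S < d `^ s ->
    (forall i, D i -> 0 < u i) -> (forall i x y, D i -> U i x -> U i y -> `|x - y| `^ s <= u i) ->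
    K `<=` \bigcup_(i in D) U i ->
    (\esum_(i in D) (u i)%:E <= S%:E)%E ->
  False.
Proof.
move=> n0 uG GM s0 G1 Gd d0 S0 Sd u0 uU KU uS.
pose hit g := [set i | D i /\ exists2 x, K x & U i (g x)].
pose inv (p : (R -> R) * R) := [/\ 0 < p.2, exists m, M m p.1,
  forall x y, 0 <= x <= 1 -> 0 <= y <= 1 -> p.2 * `|x - y| <= `|p.1 x - p.1 y|
  & (\esum_(i in hit p.1) (u i)%:E <= (p.2 `^ s * S)%:E)%E].
pose ch (p : (R -> R) * R) f := (p.1 \o f, p.2 * (lip f / 4)).
have G_ratio f : f \in G -> 0 < lip f / 4.
  by move=> /GM Mf; rewrite divr_gt0// (lip_gt0 I0 Mf).
have step p : inv p -> exists2 f, f \in G & inv (ch p f).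
  move: p => [g r] [/= r0 [m Mg] gr gS].
  have [[f fG fS]|nof] := pselect (exists2 f, f \in G &
      (\esum_(i in hit (g \o f)) (u i)%:E <= ((r * (lip f / 4)) `^ s * S)%:E)%E).
    exists f => //; have Mf := GM f fG; split => //=.
    - by rewrite mulr_gt0// G_ratio.
    - by exists (m + n)%N; exact: compositions_cat.
    - move=> x y x01 y01.
      apply: le_trans (gr _ _ (compositions01 I0 Mf x01) (compositions01 I0 Mf y01)).
      rewrite -mulrA ler_pM2l//.
      by have /andP[] := compositions_lip I0 Mf x01 y01.
  exfalso.
  have hit_disj f f' i : f \in G -> f' \in G -> hit (g \o f) i -> hit (g \o f') i -> f = f'.
    move=> fG f'G [Di [x Kx Ux]] [_ [y Ky Uy]]; apply: contrapT => ff'.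
    have /= Kfx := cf_set_compositions I0 (GM f fG) Kx.
    have /= Kfy := cf_set_compositions I0 (GM f' f'G) Ky.
    have h1 := gr _ _ (cf_set01 Kfx) (cf_set01 Kfy).
    have h2 := Gd f f' x y fG f'G ff' Kx Ky.
    have h3 : r * d <= `|g (f x) - g (f' y)|.
      by apply: le_trans h1; rewrite ler_pM2l.
    have h4 : (r * d) `^ s <= u i.
      apply: le_trans (uU i _ _ Di Ux Uy); apply: powR_le => //; first exact: ltW.
      by rewrite mulr_ge0// ltW.
    have hi : hit g i by split => //; exists (f x).
    have h5 : ((u i)%:E <= (r `^ s * S)%:E)%E.
      apply: le_trans gS; apply: le_trans (esum_seq (s := [:: i]) _ _ _) => //.
        by rewrite big_cons big_nil adde0.
      by move=> j; rewrite inE => /eqP ->.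
    rewrite lee_fin in h5.
    have := le_trans h4 h5; rewrite powRM; [|exact: ltW|exact: ltW].
    by rewrite ler_pM2l ?powR_gt0// leNgt Sd.
  have hsum : (\sum_(f <- G) \esum_(i in hit (g \o f)) (u i)%:E <= (r `^ s * S)%:E)%E.
    apply: le_trans gS.
    (* truncation makes the weights nonnegative outside [D] too *)
    rewrite (eq_bigr (fun f => \esum_(i in hit (g \o f)) (Num.max (u i) 0)%:E)%E); last first.
      move=> f _; apply: eq_esum => i [Di _].
      by rewrite max_l// ltW// u0.
    rewrite [leRHS](_ : _ = \esum_(i in hit g) (Num.max (u i) 0)%:E)%E; last first.
      apply: eq_esum => i [Di _]; by rewrite max_l// ltW// u0.
    apply: esum_disjoint_seq => //.
      by move=> i; rewrite lee_fin le_max lexx orbT.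
    move=> f fG i [Di [x Kx Ux]]; split => //; exists (f x) => //.
    exact: cf_set_compositions (GM f fG) Kx.
  have hlt f : f \in G -> (((r * (lip f / 4)) `^ s * S)%:E < \esum_(i in hit (g \o f)) (u i)%:E)%E.
    by move=> fG; rewrite ltNge; apply/negP => h; apply: nof; exists f.
  have : (\sum_(f <- G) ((r * (lip f / 4)) `^ s * S)%:E <= (r `^ s * S)%:E)%E.
    apply: le_trans hsum; rewrite big_seq [leRHS]big_seq.
    by apply: lee_sum => f fG; exact/ltW/hlt.
  rewrite sumEFin lee_fin -mulr_suml ler_pM2r//.
  rewrite (eq_big_seq (fun f => r `^ s * (lip f / 4) `^ s)).
    by rewrite -mulr_sumr ger_pMr ?powR_gt0// leNgt G1.
  by move=> f fG; rewrite powRM// ltW// G_ratio.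
have /choice[nx nxP] : forall p, exists f, inv p -> f \in G /\ inv (ch p f).
  move=> p; case: (pselect (inv p)) => [/step[f fG fP]|np]; first by exists f.
  by exists idfun.
pose st k := iter k (fun p => ch p (nx p)) (idfun, 1).
pose fs k := nx (st k).
have inv0 : inv (st 0%N).
  split => //=; first by exists 0%N.
    by move=> x y _ _; rewrite mul1r.
  rewrite powR1l mul1r; apply: le_trans uS.
  by apply: sub_esum => i [].
have inv_st k : inv (st k) by elim: k => // k IH; have [] := nxP _ IH.
have fsG k : fs k \in G by have [] := nxP _ (inv_st k).
have [k|x xP] := @cf_set_limit_points R I I0 fs.
  by exists n.-1; rewrite prednK//; exact: GM.
have stx k : (st k).1 (x k) = x 0%N.
  elim: k => [//|k IH]; rewrite -IH; have [_ ->] := xP k.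
  by [].
have st_small k : (st k).2 <= 4^-1 ^+ k.
  elim: k => [|k IH]; first by rewrite expr0.
  have /= -> : (st k.+1).2 = (st k).2 * (lip (fs k) / 4) by [].
  have [r0 _ _ _] := inv_st k.
  rewrite exprSr; apply: ler_pM => //; first exact: ltW.
    exact/ltW/G_ratio.
  rewrite -[leRHS]mul1r ler_pM2r ?invr_gt0//.
  apply: le_trans (lip_le_exp I0 (GM _ (fsG k))) _.
  by rewrite exprn_ile1 ?invr_ge0// invf_le1 ?ler1n.
have [Kx0 _] := xP 0%N.
have [i Di Ui] := KU _ Kx0.
have small k : u i <= (4^-1 `^ s) ^+ k * S.
  have [r0 _ _ hS] := inv_st k.
  have hi : hit (st k).1 i.
    by split => //; exists (x k); [have [] := xP k|rewrite stx].
  rewrite -lee_fin; apply: (@le_trans _ _ (\esum_(j in hit (st k).1) (u j)%:E)%E).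
    apply: le_trans (esum_seq (s := [:: i]) _ _ _) => //.
      by rewrite big_cons big_nil adde0.
    by move=> j; rewrite inE => /eqP ->.
  apply: le_trans hS _; rewrite lee_fin ler_pM2r//.
  rewrite -powR_mulrn ?powR_ge0// powRAC powR_mulrn ?invr_ge0//.
  by apply: powR_le => //; exact: ltW.
have [||k _] := @expr_small R (4^-1 `^ s) (u i / S).
- rewrite powR_ge0/= -[ltRHS](powR1l s).
  by apply: gt0_ltr_powR; rewrite ?nnegrE ?invr_ge0// invf_lt1 ?ltr1n.
- by rewrite divr_gt0// u0.
by rewrite ltr_pdivlMr// ltNge small.
Qed.

End MassDistribution.

Section HausdorffLowerBound.
Context {R : realType}.

(** The weights are the costs of the covering sets, increased by a summable
    sequence to make them positive. *)
Lemma hausdorff_dim_ge (I : set nat) : I !=set0 -> I `<=` posnat ->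
  (bowen_h R I <= hausdorff_dim (cf_set R I))%E.
Proof.
move=> Ine I0; apply: le_ereal_inf_tmp => _ [s [s0 Hs] <-].
rewrite leNgt; apply/negP => sh.
have [t st th] : exists2 t : R, s < t & (t%:E < bowen_h R I)%E.
  move: sh; case: (bowen_h R I) => [r| |].
  - by rewrite lte_fin => sr; exists ((s + r) / 2); rewrite ?lte_fin; lra.
  - by move=> _; exists (s + 1); rewrite ?ltry; lra.
  - by [].
have t0 : 0 < t by exact: le_lt_trans st.
have phi1 n : (0 < n)%N -> (1 <= phi I n t :> \bar R)%E.
  move=> n0; rewrite leNgt; apply/negP => pn.
  have Pt := pressure_lt0 I0 Ine t0 n0 pn.
  move: th; apply/negP; rewrite -leNgt; apply: ereal_inf_lbound.
  by exists t.
pose s' := (s + t) / 2.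
have ss' : s < s' by rewrite /s'; lra.
have s't : s' < t by rewrite /s'; lra.
have s'0 : 0 < s' by exact: le_lt_trans ss'.
have s'P : 0 < s' < t by rewrite s'0.
(* the factor [4 `^ s'] compensates the distortion constant *)
have [n n0 [G [uG GM] Gsum]] := phi_large I0 s'P phi1 (4 `^ s' * 2).
have [N hN] := compositions_seq_below GM.
set J := below I N.
have J0 : J `<=` posnat := below_posnat I0 (N := N).
have [d d0 gap] := @compositions_gap R I I0 N n.
have ds0 : 0 < d `^ s' by rewrite powR_gt0.
pose S := d `^ s' / 2; have S0 : 0 < S by rewrite divr_gt0.
have [D [U [FU U1 sumU]]] : exists D U, [/\ is_cover (cf_set R I) D U,
    forall i, D i -> (diam (U i) <= 1%:E)%E & (cover_sum s D U <= (S / 2)%:E)%E].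
  have h0 : (hausdorff_premeasure s 1 (cf_set R I) <= 0)%E.
    by rewrite -Hs; apply: ereal_sup_ubound; exists 1 => /=.
  have h1 : (hausdorff_premeasure s 1 (cf_set R I) < (S / 2)%:E)%E.
    by apply: le_lt_trans h0 _; rewrite lte_fin divr_gt0.
  have [_ [D [U [h2 h3 ->]]] h4] := ereal_inf_ltP h1.
  by exists D, U; split => //; exact: ltW.
have dU i : D i -> diam (U i) = (fine (diam (U i)))%:E.
  by move=> /U1; exact: diam_fine.
have dU01 i : D i -> 0 <= fine (diam (U i)) <= 1.
  by move=> Di; rewrite -!lee_fin -dU// diam_ge0 U1.
pose u i := fine (diam (U i)) `^ s' + S / 2 / (2 ^ i.+1)%:R.
apply: (@no_cheap_cover R J J0 n G s' d S D U u) => //.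
- by move=> f fG; apply: hN.
- rewrite (eq_big_seq (fun f => (lip f `^ s') * (4 `^ s')^-1)).
    by rewrite -mulr_suml ltr_pdivlMr ?powR_gt0// mul1r (lt_le_trans _ Gsum)// ltr_pMr ?powR_gt0// ltr1n.
  move=> f fG; have f0 := lip_gt0 I0 (GM f fG).
  by rewrite powRM ?invr_ge0 ?(ltW f0)// -powRN -powR_inv1// -powRrM mulN1r.
- by move=> f g x y fG gG; apply: gap; exact: hN.
- by rewrite /S ltr_pdivrMr// ltr_pMr// ltr1n.
- by move=> i Di; rewrite ltr_wpDl ?powR_ge0// !divr_gt0// ltr0n expn_gt0.
- move=> i x y Di Ux Uy; rewrite -[leLHS]addr0; apply: lerD; last first.
    by rewrite !divr_ge0// ltW.
  apply: powR_le => //; first exact: ltW.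
  by rewrite -lee_fin -dU//; exact: diam_ge.
- move=> x [x01 xirr [b [bJ bx]]]; apply: FU; split => //.
  by exists b; split => // k; have [] := bJ k.
- apply: (@le_trans _ _ (\esum_(i in D) ((fine (diam (U i)) `^ s')%:E + (S / 2 / (2 ^ i.+1)%:R)%:E))%E).
    by apply: le_esum => i _; rewrite EFinD.
  rewrite esumD; [|by move=> i _; rewrite lee_fin powR_ge0
                  |by move=> i _; rewrite lee_fin !divr_ge0// ltW].
  have -> : S%:E = ((S / 2)%:E + (S / 2)%:E)%E by rewrite -EFinD; congr EFin; lra.
  apply: leeD; last by apply: esum_halves; rewrite divr_ge0// ltW.
  apply: le_trans sumU; apply: le_esum => i Di.
  rewrite dU// poweR_EFin lee_fin /=; apply: powR_le_exponent; first exact: dU01.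
  by rewrite s0.
Qed.

End HausdorffLowerBound.

(** * The dimensions of the limit set *)

Section Assembly.
Context {R : realType}.
Variables (I : set nat) (I0 : I `<=` posnat) (Ine : I !=set0).
Notation F := (cf_set R I).
Notation E := (reciprocals R I).
Notation h := (bowen_h R I).
Local Open Scope ereal_scope.

Lemma bowen_h_ge0 : 0 <= h.
Proof.
by apply: le_ereal_inf_tmp => _ [t [t0 _] <-]; rewrite lee_fin ltW.
Qed.

Lemma le_from_maxe (y x : \bar R) : 0 <= x ->
  (forall theta : R, (0 < theta <= 1)%R -> y <= maxe x theta%:E) -> y <= x.
Proof.
move=> x0 hy; apply/lee_addgt0Pr => e e0.
have [m0 m1] : (0 < Num.min e 1 <= 1)%R /\ (Num.min e 1 <= e)%R.
  by rewrite lt_min e0 ltr01 !ge_min !lexx orbT.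
have e0' : 0 <= e%:E by rewrite lee_fin ltW.
apply: le_trans (hy _ m0) _; rewrite ge_max leeDl//=.
by apply: (@le_trans _ _ e%:E); [rewrite lee_fin|exact: leeDr].
Qed.

Lemma upper_dim_cf_set_le_max theta : (0 < theta <= 1)%R ->
  upper_dim theta F <= maxe h theta%:E.
Proof.
move=> t01; apply: le_trans (upper_dim_cf_set_le I0 Ine t01) _.
by rewrite ge_max le_max lexx /= le_max upper_dim_reciprocals_le// orbT.
Qed.

Lemma hausdorff_dim_cf_set : hausdorff_dim F = h.
Proof.
apply/eqP; rewrite eq_le (hausdorff_dim_ge Ine I0) andbT.
apply: le_from_maxe => [|theta t01]; first exact: bowen_h_ge0.
exact: le_trans (hausdorff_le_upper_dim theta _) (upper_dim_cf_set_le_max t01).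
Qed.

Lemma hausdorff_dim_reciprocals : hausdorff_dim E = 0.
Proof.
apply/eqP; rewrite eq_le hausdorff_dim_ge0 andbT.
apply: le_from_maxe => // theta t01.
apply: le_trans (hausdorff_le_upper_dim theta _) _.
by rewrite le_max upper_dim_reciprocals_le// orbT.
Qed.

Lemma dim_cvg_at0 (d : R -> \bar R) : d 0%R = h ->
  (forall theta, (0 < theta <= 1)%R -> h <= d theta <= maxe h theta%:E) ->
  d theta @[theta --> within `[0%R, 1%R] (nbhs (0%R : R))] --> d 0%R.
Proof.
move=> d0 dP; rewrite d0.
apply: (@squeeze_cvge _ _ _ _ (fun=> h) _ (fun theta => h + theta%:E)).
- rewrite near_withinE; apply: nearW => theta; rewrite /= in_itv/=.
  move=> /andP[]; rewrite le_eqVlt => /predU1P[<- _|t0 t1].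
    by rewrite d0 lexx adde0 lexx.
  have [|-> /le_trans] := andP (dP theta _); first by rewrite t0.
  by apply; rewrite ge_max leeDl ?leeDr ?bowen_h_ge0// lee_fin ltW.
- exact: cvg_cst.
- rewrite -[X in _ --> X]adde0; apply: cvgeD.
  + exact: fin_num_adde_defl.
  + exact: cvg_cst.
  + apply: cvg_within_filter; apply: cvg_EFin; [exact: nearW|exact: cvg_id].
Qed.

End Assembly.

Theorem theorem4p3 (R : realType) (I : set nat) :
  I !=set0 -> I `<` posnat ->
  (forall theta : R, 0 <= theta <= 1 ->
     upper_dim theta (cf_set R I)
       = maxe (bowen_h R I) (upper_dim theta (reciprocals R I))
     /\ (maxe (bowen_h R I) (lower_dim theta (reciprocals R I))
           <= lower_dim theta (cf_set R I))%E
     /\ (lower_dim theta (cf_set R I)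
           <= maxe (bowen_h R I) (upper_dim theta (reciprocals R I)))%E)
  /\
  (upper_dim theta (cf_set R I) @[theta --> within `[0, 1] (nbhs (0 : R))]
     --> upper_dim 0 (cf_set R I)
   /\
   lower_dim theta (cf_set R I) @[theta --> within `[0, 1] (nbhs (0 : R))]
     --> lower_dim 0 (cf_set R I)).
Proof.
move=> Ine /properW I0.
have hF := hausdorff_dim_cf_set I0 Ine.
split.
  move=> theta /andP[]; rewrite le_eqVlt => /predU1P[<- _|t0 t1].
    rewrite !upper_dim0 !lower_dim0 hF hausdorff_dim_reciprocals//.
    by rewrite max_l ?bowen_h_ge0// lexx.
  have t01 : 0 < theta <= 1 by rewrite t0.
  have [hl hu] := @dim_reciprocals_le R I I0 theta Ine t0.
  have uF := upper_dim_cf_set_le I0 Ine t01.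
  split; last split.
  - apply/eqP; rewrite eq_le uF ge_max hu andbT /=.
    by rewrite -hF hausdorff_le_upper_dim.
  - by rewrite ge_max hl andbT -hF hausdorff_le_lower_dim.
  - exact: le_trans (lower_le_upper_dim _ _) uF.
split; apply: (dim_cvg_at0 (I := I)).
- by rewrite upper_dim0.
- move=> theta t01; rewrite upper_dim_cf_set_le_max// andbT.
  by rewrite -hF hausdorff_le_upper_dim.
- by rewrite lower_dim0.
- move=> theta t01; rewrite -{1}hF hausdorff_le_lower_dim/=.
  exact: le_trans (lower_le_upper_dim _ _) (upper_dim_cf_set_le_max I0 Ine t01).
Qed.
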